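(* Let $q=p^n$ with $p$ prime and $n\ge2$ such that $3\le q/p$. For each integer $a$ with $2\le a\le q/p-1$, there exists an AG code over $\mathbb{F}_{q^2}$ with parameters $$\left[\frac{q^3}{p},\ a+\frac{pa(a-1)}{2},\ \frac{q^3}{p}-(q+1)(a-1)\right].$$
   Context: A code with parameters $[N,k,d]$ over a finite field $\mathbb{F}$ is a linear subspace of $\mathbb{F}^N$ of dimension $k$ whose minimum Hamming distance is exactly $d$. An (algebraic geometry) AG code over $\mathbb{F}$ is a code of the form $C_{\mathcal{L}}(D,G)=\{(f(P_1),\dots,f(P_N))\mid f\in\mathcal{L}(G)\}\subseteq\mathbb{F}^N$, where $F/\mathbb{F}$ is a function field with full constant field $\mathbb{F}$, $D=P_1+\dots+P_N$ is a sum of pairwise distinct rational (degree-one) places, $G$ is a divisor of $F$ with support disjoint from that of $D$, and $\mathcal{L}(G)=\{z\in F\mid(z)+G\ge0\}\cup\{0\}$. *)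

(* Defs.v *)
From HB Require Import structures.
From mathcomp Require Import all_boot all_order all_algebra all_field.
From mathcomp Require Import boolp classical_sets cardinality.

Set Implicit Arguments.
Unset Strict Implicit.
Unset Printing Implicit Defensive.

Import GRing.Theory.
Local Open Scope classical_set_scope.
Local Open Scope ring_scope.

(* A function field in one variable over K is a finite extension of a rational
   function field K(x), hence F : fieldExtType {fraction {poly K}} (the map
   'X |-> x identifies {fraction {poly K}} with K(x)).  Apart from its type, F
   enters the notions below only through its field structure and the
   embedding of K; in particular they do not depend on the choice of x. *)

Section FunctionField.

Variables (K : fieldType) (F : fieldExtType {fraction {poly K}}).

Definition kconst (c : K) : F := (tofrac c%:P)%:A.

Definition full_constant_field : Prop :=
  forall z : F, algebraicOver kconst z -> exists c : K, z = kconst c.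

Definition valuation_ring (O : pred F) : Prop :=
  [/\ subring_closed O,
      forall c : K, kconst c \in O,
      exists2 z, z \in O & forall c : K, z <> kconst c,
      exists z, z \notin O
    & forall z, z \in O \/ z^-1 \in O].

(* A place P is the maximal ideal of a valuation ring O_P; each determines the
   other, and it is O_P that is stored.  (F -> bool and not {pred F}, whose
   universe is too large for the type set place.) *)
Record place := Place {
  place_ring : F -> bool;
  place_ringP : valuation_ring place_ring
}.

Definition place_unit (P : place) : {pred F} :=
  [pred z | [&& z != 0, z \in place_ring P & z^-1 \in place_ring P]].

Definition place_ideal (P : place) : {pred F} :=
  [pred z | (z \in place_ring P) && (z \notin place_unit P)].

(* [O_P / P : K] = d: the classes of the b i form a K-basis of O_P / P. *)
Definition place_degree (P : place) (d : nat) : Prop :=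
  exists b : 'I_d -> F,
    (forall i, b i \in place_ring P) /\
    (forall z, z \in place_ring P ->
       exists! c : 'rV[K]_d,
         z - \sum_(i < d) kconst (c 0 i) * b i \in place_ideal P).

Definition rational_place (P : place) : Prop := place_degree P 1.

(* f(P), the class of f in O_P / P = K; meaningful for P rational and f in
   O_P, and then the unique such c. *)
Definition place_eval (P : place) (f : F) : K :=
  xget 0 [set c : K | f - kconst c \in place_ideal P].

Definition prime_element (P : place) (t : F) : Prop :=
  forall z, z \in place_ideal P <->
    exists2 w, w \in place_ring P & z = t * w.

(* v_P(z) for z <> 0; the value at 0, which should be infinite, is never
   used. *)
Definition valuation (P : place) (z : F) : int :=
  xget 0 [set n : int | exists t u : F,
    [/\ prime_element P t, u \in place_unit P & z = t ^ n * u]].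

Record divisor := Divisor {
  divisor_coef :> place -> int;
  divisor_finite : finite_set [set P : place | divisor_coef P != 0]
}.

Definition riemann_roch_space (G : divisor) : set F :=
  [set z | z = 0 \/ forall P : place, 0 <= valuation P z + G P].

(* C_L(D, G) with D = P_0 + ... + P_(N-1). *)
Definition AG_code_set (N : nat) (P : 'I_N -> place) (G : divisor) :
    set 'rV[K]_N :=
  [set \row_i place_eval (P i) f | f in riemann_roch_space G].

End FunctionField.

Definition is_AG_code (K : fieldType) (N : nat) (C : {vspace 'rV[K]_N}) :
    Prop :=
  exists (F : fieldExtType {fraction {poly K}})
         (P : 'I_N -> place F) (G : divisor F),
    [/\ full_constant_field F,
        injective P,
        forall i, rational_place (P i),
        forall i, G (P i) = 0
      & forall c : 'rV[K]_N, c \in C <-> AG_code_set P G c].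

Definition hamming_dist (K : fieldType) (N : nat) (x y : 'rV[K]_N) : nat :=
  #|[pred i | x 0 i != y 0 i]|.

Definition min_distance (K : fieldType) (N : nat) (C : {vspace 'rV[K]_N})
    (d : nat) : Prop :=
  (exists x y, [/\ x \in C, y \in C, x != y & hamming_dist x y = d]) /\
  (forall x y, x \in C -> y \in C -> x != y -> (d <= hamming_dist x y)%N).

(* Parameters [N, k, d]; the length N is carried by the type of C. *)
Definition code_parameters (K : fieldType) (N : nat) (C : {vspace 'rV[K]_N})
    (k d : nat) : Prop :=
  \dim C = k /\ min_distance C d.

(* Main.v *)
Require Import Defs.
From HB Require Import structures.
From mathcomp Require Import all_boot all_order all_algebra all_field.
From mathcomp Require Import generic_quotient zify ring.
From mathcomp Require Import boolp classical_sets cardinality.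

Set Implicit Arguments.
Unset Strict Implicit.
Unset Printing Implicit Defensive.

Import GRing.Theory Order.TTheory Num.Theory.
Local Open Scope ring_scope.

(** The code is one-point: C = C_L(D, G) with G = (a - 1)(q + 1) P_inf on the
    curve
      y ^ (q / p) + ... + y ^ p + y = w x ^ (q + 1),   w ^ q = - w <> 0,
    over F_(q^2), where D is the sum of all its affine rational points and
    P_inf its only point at infinity.

    Put l = q / p.  At P_inf the functions x and y have poles of the coprime
    orders l and q + 1, so the monomials x ^ i y ^ j with j < l, which form a
    K-basis of K[x, y], have pairwise distinct pole orders l i + (q + 1) j.
    The functions without any other pole are exactly K[x, y], because the curve
    is smooth at every affine point.  Hence L(G) is spanned by the monomials
    with l i + (q + 1) j <= (q + 1)(a - 1), that is, i <= p (a - 1 - j): there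
    are a + p a (a - 1) / 2 of them.

    For every x in F_(q^2) the right-hand side u = w x ^ (q + 1) satisfies
    u ^ q = - u, and then L(Y) - u divides Y ^ (q^2) - Y, L being the left-hand
    side.  So every x lies under l rational points, and D has degree
    q^2 l = q^3 / p.  A nonzero function of L(G) has at most (q + 1)(a - 1)
    zeros.  Equality holds for the product of a - 1 functions y - b with
    L(b) = w, since x ^ (q + 1) = 1 has q + 1 solutions.

    The proof is elementary and works with polynomials f in K[X][Y] of degree
    less than l in Y, the reduced ones.  The substitution X = s ^ l,
    Y = mu s ^ (q + 1), with mu ^ l = w, separates the weights of monomials and
    is compatible with reduction modulo the curve up to lower terms
    ([filtered_red]).  This gives the multiplicativity of the weight
    ([wt_redM]), from which follow both the irreducibility of the equation over
    K(x) ([curve_poly_irreducible]) and the valuation at infinity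
    ([inf_valP]).  The place at infinity is the only one where x has a pole
    ([place_of_pole_X]), so functions of K[x, y] are regular elsewhere.

    The places at affine points (al, be) over a finite extension of K of
    cardinal Q rest on one remark: for a in K[x, y] the function a - a ^ Q
    vanishes at all points of the fibre of x = al, which has l distinct points
    because L is additive with l roots in K; hence it is divisible by the
    minimal polynomial of al at x ([local_principal]).  A function with a
    denominator has a pole at such a place ([pole_of_denominator]), and this
    determines L(G) ([riemann_roch_inf]).  Zeros are counted on the norm
    prod_ga f(x, y + ga) over the roots ga of L, a polynomial in x of degree at
    most the weight of f ([norm_in_Kx], [card_zeros]). *)

(** * Finite fields *)

Lemma finite_root_extension (K : finFieldType) (p : {poly K}) :
  (1 < size p)%N ->
  exists (K' : finFieldType) (iota : {rmorphism K -> K'}) (x : K'),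
    root (map_poly iota p) x.
Proof.
move=> sz_p; have p0 : p != 0 by rewrite -size_poly_gt0 ltnW.
have [E [s Dp _]] := FinSplittingFieldFor p0.
exists (FinFieldExtType E), (in_alg E : {rmorphism K -> E}).
have : size (map_poly (in_alg E) p) = (size s).+1.
  by rewrite (eqp_size Dp) size_prod_XsubC.
rewrite size_map_poly => szs; case: s Dp szs => [|x s] Dp szs.
  by rewrite szs in sz_p.
exists x; change (root (map_poly (in_alg E) p) x).
by rewrite (eqp_root Dp) root_prod_XsubC mem_head.
Qed.

(** X^#|K| - X is the product of the X - x over x in K, so that its divisors split
    into distinct linear factors. *)
Lemma card_roots_dvd_genPoly (K : finFieldType) (D : {poly K}) :
  D %| 'X^#|K| - 'X -> #|[set x | root D x]%SET| = (size D).-1.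
Proof.
rewrite finField_genPoly -big_enum /= => /(@dvdp_prod_XsubC _ _ _ idfun) [m Dm].
have um : uniq (mask m (enum K)) by rewrite mask_uniq ?enum_uniq.
rewrite (eqp_size Dm) size_prod_XsubC /= -(card_uniqP um).
apply: eq_card => x; rewrite inE (eqp_root Dm).
by rewrite (root_prod_XsubC (mask m (enum K))).
Qed.

(** * Places and discrete valuations *)

Section Places.
Variables (K : fieldType) (F : fieldExtType {fraction {poly K}}).

HB.instance Definition _ := GRing.RMorphism.copy (kconst F)
  (in_alg F \o (@tofrac {poly K}) \o polyC).

Implicit Types (P : place F) (z w t u : F).

Lemma place_eqP P P' : place_ring P =1 place_ring P' -> P = P'.
Proof.
case: P P' => [O OP] [O' O'P] /= /funext eqO.
by case: _ / eqO in O'P *; congr Place; apply: Prop_irrelevance.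
Qed.

Section OnePlace.
Variable P : place F.
Local Notation O := (place_ring P).

Lemma place_ring1 : 1 \in O. Proof. by case: (place_ringP P) => -[]. Qed.
Lemma place_ringB z w : z \in O -> w \in O -> z - w \in O.
Proof. by case: (place_ringP P) => -[_ + _] _ _ _ _; apply. Qed.
Lemma place_ringM z w : z \in O -> w \in O -> z * w \in O.
Proof. by case: (place_ringP P) => -[_ _ +] _ _ _ _; apply. Qed.
Lemma place_ring0 : 0 \in O.
Proof. by rewrite -(subrr 1) place_ringB ?place_ring1. Qed.
Lemma place_ringN z : z \in O -> - z \in O.
Proof. by rewrite -sub0r; apply: place_ringB; apply: place_ring0. Qed.
Lemma place_ringD z w : z \in O -> w \in O -> z + w \in O.
Proof. by move=> Oz /place_ringN; rewrite -{2}[w]opprK; apply: place_ringB. Qed.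
Lemma place_ringX z n : z \in O -> z ^+ n \in O.
Proof.
by move=> Oz; elim: n => [|n IH]; rewrite ?place_ring1 // exprS place_ringM.
Qed.
Lemma place_ring_sum (I : Type) (r : seq I) (A : pred I) (E : I -> F) :
  (forall i, A i -> E i \in O) -> \sum_(i <- r | A i) E i \in O.
Proof.
by move=> OE; elim/big_ind: _ => //; [apply: place_ring0 | apply: place_ringD].
Qed.
Lemma place_ring_const c : kconst F c \in O.
Proof. by case: (place_ringP P). Qed.
Lemma place_ring_inv z : z \notin O -> z^-1 \in O.
Proof. by case: (place_ringP P) => _ _ _ _ /(_ z) [->|]. Qed.

Lemma place_unit_neq0 u : u \in place_unit P -> u != 0.
Proof. by rewrite inE => /and3P[]. Qed.
Lemma place_unit_ring u : u \in place_unit P -> u \in O.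
Proof. by rewrite inE => /and3P[]. Qed.
Lemma place_unitV u : u \in place_unit P -> u^-1 \in place_unit P.
Proof. by rewrite !inE invrK invr_eq0 => /and3P[-> -> ->]. Qed.
Lemma place_unitM u w :
  u \in place_unit P -> w \in place_unit P -> u * w \in place_unit P.
Proof.
rewrite !inE => /and3P[u0 Ou Ou'] /and3P[w0 Ow Ow'].
by rewrite mulf_neq0 //= invfM !place_ringM.
Qed.
Lemma place_unit1 : 1 \in place_unit P.
Proof. by rewrite inE invr1 oner_eq0 place_ring1. Qed.
Lemma place_unitX u n : u \in place_unit P -> u ^+ n \in place_unit P.
Proof.
by move=> Uu; elim: n => [|n IH]; rewrite ?place_unit1 // exprS place_unitM.
Qed.
Lemma place_unit_const c : c != 0 -> kconst F c \in place_unit P.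
Proof.
move=> c0; rewrite inE fmorph_eq0 c0 place_ring_const /=.
by rewrite -fmorphV place_ring_const.
Qed.

Lemma place_ideal_ring z : z \in place_ideal P -> z \in O.
Proof. by rewrite inE => /andP[]. Qed.
Lemma place_ideal_nunit z : z \in place_ideal P -> z \notin place_unit P.
Proof. by rewrite inE => /andP[]. Qed.
Lemma place_ideal0 : 0 \in place_ideal P.
Proof. by rewrite inE place_ring0 /= inE eqxx. Qed.
Lemma place_idealE z : z != 0 -> (z \in place_ideal P) = (z^-1 \notin O).
Proof.
move=> z0; rewrite !inE z0 /=; apply/andP/idP => [[-> //]|Oz'].
by rewrite (negPf Oz') andbF -[z]invrK place_ring_inv.
Qed.
Lemma place_idealM z w : z \in place_ideal P -> w \in O -> z * w \in place_ideal P.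
Proof.
have [->|w0] := eqVneq w 0; first by rewrite mulr0 place_ideal0.
have [->|z0] := eqVneq z 0; first by rewrite mul0r place_ideal0.
rewrite !place_idealE ?mulf_neq0 // => + Ow; apply: contra => Ozw.
by rewrite -(mulfK w0 z^-1) mulrAC -invfM place_ringM.
Qed.
Lemma place_idealD z w :
  z \in place_ideal P -> w \in place_ideal P -> z + w \in place_ideal P.
Proof.
have [->|w0] := eqVneq w 0; first by rewrite addr0.
have [->|z0] := eqVneq z 0; first by rewrite add0r.
move=> Pz Pw; case: (boolP (z / w \in O)) => [Ozw|/place_ring_inv].
  rewrite -(divfK w0 z) -[X in _ + X]mul1r -mulrDl mulrC place_idealM //.
  by rewrite place_ringD ?place_ring1.
rewrite invf_div => Owz; rewrite -(divfK z0 w) -[X in X + _]mul1r -mulrDl mulrC.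
by rewrite place_idealM // place_ringD ?place_ring1.
Qed.
Lemma place_idealN z : z \in place_ideal P -> - z \in place_ideal P.
Proof. by rewrite -mulrN1 => /place_idealM-> //; rewrite place_ringN ?place_ring1. Qed.
Lemma place_idealB z w :
  z \in place_ideal P -> w \in place_ideal P -> z - w \in place_ideal P.
Proof. by move=> Pz /place_idealN; apply: place_idealD. Qed.
Lemma place_ideal_sum (I : Type) (r : seq I) (A : pred I) (E : I -> F) :
  (forall i, A i -> E i \in place_ideal P) ->
  \sum_(i <- r | A i) E i \in place_ideal P.
Proof.
by move=> OE; elim/big_ind: _ => //; [apply: place_ideal0 | apply: place_idealD].
Qed.
Lemma place_idealX z n : (0 < n)%N -> z \in place_ideal P -> z ^+ n \in place_ideal P.
Proof.
by case: n => // n _ Pz; rewrite exprS place_idealM // place_ringX ?place_ideal_ring.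
Qed.
Lemma place_idealX_rad z n : z ^+ n \in place_ideal P -> z \in place_ideal P.
Proof.
have [->|z0] := eqVneq z 0; first by rewrite place_ideal0.
rewrite !place_idealE ?expf_neq0 //; apply: contra => Oz.
by rewrite -exprVn place_ringX.
Qed.
Lemma place_unitD u z :
  u \in place_unit P -> z \in place_ideal P -> u + z \in place_unit P.
Proof.
move=> Uu Pz; apply: contraT => nU.
have Puz : u + z \in place_ideal P.
  apply/andP; split=> //.
  exact: place_ringD (place_unit_ring Uu) (place_ideal_ring Pz).
have := place_ideal_nunit (place_idealB Puz Pz).
by rewrite addrK Uu.
Qed.
Lemma place_ideal_const c : kconst F c \in place_ideal P -> c = 0.
Proof.
move=> Pc; apply/eqP; apply: contraT => /place_unit_const.
by rewrite (negPf (place_ideal_nunit Pc)).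
Qed.

(** Valuation rings are integrally closed: if z is not in O, dividing the equation of
    z by z ^ (deg f - 1) expresses z as a polynomial in z^-1. *)
Lemma place_ring_integral (f : {poly F}) z :
  f \is monic -> (forall i, f`_i \in O) -> root f z -> z \in O.
Proof.
move=> mf Of /rootP fz; apply: contraT => nOz.
have z0 : z != 0 by apply: contraNneq nOz => ->; apply: place_ring0.
have Oz' := place_ring_inv nOz.
have [n szf] : exists n, size f = n.+2.
  case E: (size f) => [|[|n]]; last by exists n.
    by move: (monic_neq0 mf); rewrite -size_poly_eq0 E.
  move: fz; have f1 : f = 1.
    rewrite (size1_polyC (eq_leq E)); move/monicP: mf; rewrite lead_coefE E.
    by move=> /= ->.
  by rewrite f1 hornerC => /eqP; rewrite oner_eq0.
move: fz; rewrite horner_coef szf big_ord_recr /=.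
have -> : f`_n.+1 = 1 by move/monicP: mf; rewrite lead_coefE szf.
rewrite mul1r => /(congr1 (fun e => z^-1 ^+ n * e)).
rewrite mulr0 mulrDr exprS mulrCA -exprMn mulVf // expr1n mulr1.
move=> /eqP; rewrite addr_eq0 => /eqP E.
suff: z \in O by rewrite (negPf nOz).
rewrite -[z]opprK place_ringN // -E mulr_sumr place_ring_sum // => i _.
rewrite mulrCA place_ringM //.
have: (i <= n)%N by rewrite -ltnS.
move: (i : nat) => j le_in; rewrite -(subnK le_in) exprD -mulrA -exprMn mulVf //.
rewrite expr1n mulr1.
exact: place_ringX.
Qed.

Lemma place_ring_algebraic z : algebraicOver (kconst F) z -> z \in O.
Proof.
move=> /integral_algebraic [f mf fz].
apply: place_ring_integral fz; first by rewrite map_monic.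
by move=> i; rewrite coef_map place_ring_const.
Qed.

Lemma prime_element_ideal t : prime_element P t -> t \in place_ideal P.
Proof. by move=> pt; apply/pt; exists 1; rewrite ?place_ring1 ?mulr1. Qed.

Lemma prime_element_neq0 t : prime_element P t -> t != 0.
Proof.
move=> pt; apply/eqP => t0; case: (place_ringP P) => _ _ _ [z nOz] _.
have z0 : z != 0 by apply: contraNneq nOz => ->; apply: place_ring0.
have : z^-1 \in place_ideal P by rewrite place_idealE ?invr_eq0 // invrK.
by case/pt => w _; rewrite t0 mul0r => /eqP; rewrite invr_eq0 (negPf z0).
Qed.

(** If the place has no prime element, [valuation] takes its default value 0. *)
Lemma valuation_ge0 z : z \in O -> 0 <= valuation P z.
Proof.
move=> Oz; rewrite /valuation; case: xgetP => [n _ [t [u [pt Uu zE]]]|//].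
case: n zE => [//|n] zE.
have t0 := prime_element_neq0 pt.
have : u \in place_ideal P.
  have -> : u = t ^+ n.+1 * z.
    by rewrite zE NegzE -exprnN mulrA divff ?mul1r // expf_neq0.
  by rewrite place_idealM // place_idealX // prime_element_ideal.
by move/place_ideal_nunit; rewrite Uu.
Qed.

(** An element algebraic over K has a constant residue at a rational place, so
    that its difference with that constant, being a nonunit, must vanish: all
    nonzero algebraic elements are units. *)
Lemma full_constant_field_of_rational :
  rational_place P -> full_constant_field F.
Proof.
move=> [b [Ob Pb]] z Az.
have algC c : algebraicOver (kconst F) (kconst F c).
  exact: algebraic_id.
have [c1 [+ _]] := Pb 1 place_ring1; rewrite big_ord1 => c1P.
(* b0 is an arbitrary basis of the residue field; a1 makes a1 b0 = 1 mod P. *)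
set b0 := b ord0 in c1P.
have [c [+ _]] := Pb z (place_ring_algebraic Az).
rewrite big_ord1 => cP; rewrite -/b0 in cP.
set a1 := c1 0 ord0 in c1P; set a := c 0 ord0 in cP.
have a1_0 : a1 != 0.
  apply/eqP => a10; move: c1P; rewrite a10 rmorph0 mul0r subr0.
  by move/place_ideal_nunit; rewrite place_unit1.
have Pza : z - kconst F (a / a1) \in place_ideal P.
  have -> : z - kconst F (a / a1) =
    (z - kconst F a * b0) - kconst F (a / a1) * (1 - kconst F a1 * b0).
    by rewrite mulrBr mulr1 mulrA -rmorphM divfK // opprB addrA subrK.
  by rewrite place_idealB // mulrC place_idealM // place_ring_const.
exists (a / a1); apply/eqP; rewrite -subr_eq0; apply: contraLR Pza => z0.
rewrite place_idealE // negbK; apply: place_ring_algebraic.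
by apply: algebraic_inv; apply: algebraic_sub.
Qed.

End OnePlace.

(** The laws of a normalised discrete valuation with uniformizer t, on nonzero
    elements. *)
Record discrete_valuation (v : F -> int) (t : F) : Prop := DiscreteValuation {
  dval_t0 : t != 0;
  dval_t : v t = 1;
  dval_const : forall c : K, c != 0 -> v (kconst F c) = 0;
  dvalM : forall z w, z != 0 -> w != 0 -> v (z * w) = v z + v w;
  dvalD : forall k z w, z != 0 -> w != 0 -> z + w != 0 ->
     k <= v z -> k <= v w -> k <= v (z + w)
}.

Section DiscreteValuation.
Variables (v : F -> int) (t : F) (vP : discrete_valuation v t).

Definition dval_ring z := (z == 0) || (0 <= v z).

Lemma dval1 : v 1 = 0.
Proof. by have := dval_const vP (oner_neq0 K); rewrite rmorph1. Qed.

Lemma dvalV z : z != 0 -> v z^-1 = - v z.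
Proof.
move=> z0; apply/eqP; rewrite -addr_eq0 addrC -(dvalM vP) ?invr_eq0 //.
by rewrite divff // dval1.
Qed.

Lemma dvalN z : z != 0 -> v (- z) = v z.
Proof.
move=> z0; rewrite -mulN1r (dvalM vP) ?oppr_eq0 ?oner_eq0 //.
have := dval_const vP (_ : -1 != 0 :> K); rewrite oppr_eq0 oner_eq0.
by rewrite rmorphN rmorph1 => ->; rewrite ?add0r.
Qed.

Lemma dval_expz z n : z != 0 -> v z = 1 -> v (z ^ n) = n.
Proof.
move=> z0 vz; have vX k : v (z ^+ k) = k%:Z.
  elim: k => [|k IH]; first by rewrite dval1.
  by rewrite exprS (dvalM vP) ?expf_neq0 // IH vz -intS.
case: n => k; first exact: vX.
by rewrite NegzE -exprnN dvalV ?expf_neq0 // vX.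
Qed.

Lemma dval_ringP : valuation_ring dval_ring.
Proof.
have t0 := dval_t0 vP; have vt := dval_t vP.
rewrite /dval_ring /in_mem /=; split.
- split; rewrite /in_mem /=; first by rewrite dval1 lexx orbT.
    move=> z w; rewrite /in_mem /=.
    have [->|w0] := eqVneq w 0; first by rewrite subr0.
    have [->|z0] := eqVneq z 0; first by rewrite sub0r dvalN // oppr_eq0 (negPf w0).
    rewrite /= => vz vw; have [//|zw] := eqVneq (z - w) 0.
    by apply: (dvalD vP) => //; rewrite ?oppr_eq0 ?dvalN.
  move=> z w; rewrite /in_mem /=.
  have [->|w0] := eqVneq w 0; first by rewrite mulr0 eqxx.
  have [->|z0] := eqVneq z 0; first by rewrite mul0r eqxx.
  by rewrite /= => vz vw; rewrite (dvalM vP) // addr_ge0 ?orbT.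
- move=> c; rewrite /in_mem /=; have [->|c0] := eqVneq c 0; first by rewrite rmorph0 eqxx.
  by rewrite (dval_const vP) // lexx orbT.
- exists t; first by rewrite /in_mem /= vt ler01 orbT.
  move=> c tc; move: vt t0; rewrite tc fmorph_eq0 => + c0.
  by rewrite (dval_const vP).
- by exists t^-1; rewrite /in_mem /= dvalV // vt invr_eq0 (negPf t0).
move=> z; have [|z0] := eqVneq z 0; first by move->; left; rewrite /in_mem /= eqxx.
rewrite /in_mem /= invr_eq0 (negPf z0) dvalV // oppr_ge0; apply/orP; exact: le_total.
Qed.

Definition dval_place : place F := Place dval_ringP.

Lemma dval_place_ring z : z != 0 -> (z \in place_ring dval_place) = (0 <= v z).
Proof. by move=> z0; rewrite /in_mem /= /dval_ring (negPf z0). Qed.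

Lemma dval_place_ideal z :
  z != 0 -> (z \in place_ideal dval_place) = (0 < v z).
Proof.
move=> z0; rewrite place_idealE // dval_place_ring ?invr_eq0 //.
by rewrite dvalV // oppr_ge0 ltNge.
Qed.

Lemma dval_place_unit z :
  z != 0 -> (z \in place_unit dval_place) = (v z == 0).
Proof.
move=> z0; rewrite inE z0 !dval_place_ring ?invr_eq0 // dvalV // oppr_ge0 /=.
by rewrite eq_le andbC.
Qed.

Lemma dval_place_prime : prime_element dval_place t.
Proof.
have t0 := dval_t0 vP; move=> z; split; last first.
  case=> w Ow ->; rewrite place_idealM //.
  by rewrite dval_place_ideal // (dval_t vP).
have [->|z0] := eqVneq z 0; first by exists 0; rewrite ?place_ring0 ?mulr0.
rewrite dval_place_ideal // => vz; exists (t^-1 * z); last by rewrite mulVKf.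
rewrite dval_place_ring ?mulf_neq0 ?invr_eq0 //.
by rewrite (dvalM vP) ?invr_eq0 // dvalV // (dval_t vP) addrC subr_ge0.
Qed.

(** [valuation] may pick any prime element t'; as t and t' divide each other in the
    valuation ring, v t' = 1 and the exponent it returns is v z. *)
Lemma dval_place_valuation z : z != 0 -> valuation dval_place z = v z.
Proof.
move=> z0; have t0 := dval_t0 vP.
rewrite /valuation; case: xgetP => [n _ [t' [u [pt' Uu zE]]]|none]; last first.
  case: (none (v z)); exists t, (t ^ (- v z) * z); split.
  - exact: dval_place_prime.
  - rewrite dval_place_unit ?mulf_neq0 ?expfz_neq0 //.
    by rewrite (dvalM vP) ?expfz_neq0 // dval_expz ?(dval_t vP) // addNr.
  - by rewrite mulrA -expfzDr // subrr mul1r.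
have t'0 := prime_element_neq0 pt'.
have vt' : v t' = 1.
  apply/eqP; rewrite eq_le; apply/andP; split; last first.
    by have := prime_element_ideal pt'; rewrite dval_place_ideal.
  have : t \in place_ideal dval_place by rewrite dval_place_ideal // (dval_t vP).
  case/pt' => w Ow tE; have w0 : w != 0.
    by apply: contraNneq t0 => w0; rewrite tE w0 mulr0.
  have := dval_t vP; rewrite tE (dvalM vP) // => <-.
  by rewrite lerDl -dval_place_ring.
have u0 := place_unit_neq0 Uu.
rewrite zE (dvalM vP) ?expfz_neq0 // dval_expz //.
by move: Uu; rewrite dval_place_unit // => /eqP->; rewrite addr0.
Qed.

End DiscreteValuation.
End Places.

(** * Polynomials in two variables and their values *)

Section Eval2.
Variables (K : fieldType) (E : comNzRingType).

(** Values at points, elements of the function field and the weight substitution are all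
    instances of this one morphism out of K[X][Y]. *)
Definition eval2 (h : {rmorphism {poly K} -> E}) (y : E) : {poly {poly K}} -> E :=
  horner_morph (fun c => mulrC y (h c)).

HB.instance Definition _ h y := GRing.RMorphism.on (eval2 h y).

Variables (h : {rmorphism {poly K} -> E}) (y : E).

Lemma eval2C c : eval2 h y c%:P = h c.
Proof. exact: horner_morphC. Qed.
Lemma eval2X : eval2 h y 'X = y.
Proof. exact: horner_morphX. Qed.

Lemma eval2_sum n (f : {poly {poly K}}) : (size f <= n)%N ->
  eval2 h y f = \sum_(j < n) h f`_j * y ^+ j.
Proof.
move=> szf; rewrite /eval2 /horner_morph (@horner_coef_wide _ n) //.
  by apply: eq_bigr => j _; rewrite coef_map.
exact: leq_trans (size_poly _ _) szf.
Qed.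

Lemma eval2_map_polyC (L : {poly K}) :
  eval2 h y (map_poly polyC L) = (map_poly (h \o polyC) L).[y].
Proof. by rewrite /eval2 /horner_morph -map_poly_comp. Qed.
End Eval2.

Section PointValue.
Variables (K K' : fieldType) (iota : {rmorphism K -> K'}).

Definition base_eval (al : K') : {poly K} -> K' :=
  horner_morph (fun c => mulrC al (iota c)).
HB.instance Definition _ al := GRing.RMorphism.on (base_eval al).
Definition point_eval (al be : K') : {poly {poly K}} -> K' := eval2 (base_eval al) be.
HB.instance Definition _ al be := GRing.RMorphism.on (point_eval al be).
Local Notation phi := point_eval.

Lemma base_evalE al c : base_eval al c = (map_poly iota c).[al]. Proof. by []. Qed.
Lemma point_evalC al be c : phi al be c%:P = base_eval al c. Proof. exact: eval2C. Qed.
Lemma point_eval_const al be c : phi al be c%:P%:P = iota c.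
Proof. by rewrite point_evalC [base_eval _ _]horner_morphC. Qed.
Lemma point_eval_X al be : phi al be 'X%:P = al.
Proof. by rewrite point_evalC [base_eval _ _]horner_morphX. Qed.
Lemma point_eval_Y al be : phi al be 'X = be. Proof. exact: eval2X. Qed.

Lemma point_evalD al be f g : phi al be (f + g) = phi al be f + phi al be g.
Proof. exact: rmorphD. Qed.
Lemma point_evalB al be f g : phi al be (f - g) = phi al be f - phi al be g.
Proof. exact: rmorphB. Qed.
Lemma point_evalXn al be f n : phi al be (f ^+ n) = phi al be f ^+ n.
Proof. exact: rmorphXn. Qed.
Lemma point_eval0 al be : phi al be 0 = 0. Proof. exact: rmorph0. Qed.
Lemma point_eval1 al be : phi al be 1 = 1. Proof. exact: rmorph1. Qed.
Lemma point_evalM al be f g : phi al be (f * g) = phi al be f * phi al be g.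
Proof. exact: rmorphM. Qed.

Lemma horner_shift L (ga : K) (be : K') : L \Po ('X + ga%:P) = L ->
  (map_poly iota L).[be + iota ga] = (map_poly iota L).[be].
Proof.
move=> LE; rewrite -[in RHS]LE map_comp_poly horner_comp rmorphD /= map_polyX.
by rewrite map_polyC hornerD hornerX hornerC.
Qed.
End PointValue.

Section PointMinPoly.
Variables (K : fieldType) (K' : finFieldType) (iota : {rmorphism K -> K'}).

(** With Q = #|K'|, al is a root of X^Q - X; a nonzero polynomial of least degree killing
    al divides all the others. *)
Lemma point_min_poly (al : K') : exists2 pi : {poly K}, pi != 0 &
  forall c, base_eval iota al c = 0 <-> pi %| c.
Proof.
pose P n := `[<exists c : {poly K}, [/\ c != 0, base_eval iota al c = 0 & size c = n]>].
have exP : exists n, P n.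
  exists (size ('X^#|K'| - 'X : {poly K})); apply/asboolP; exists ('X^#|K'| - 'X).
  split=> //; last first.
    by rewrite rmorphB rmorphXn /= [base_eval _ _ _]horner_morphX expf_card subrr.
  apply/eqP => /(congr1 (fun c : {poly K} => c`_1)); rewrite coefB coefXn coefX coef0.
  by rewrite ltn_eqF ?finNzRing_gt1 // sub0r => /eqP; rewrite oppr_eq0 oner_eq0.
case: (ex_minnP exP) => n /asboolP[pi [pi0 pial szpi]] minn.
exists pi => // c; split; last first.
  by case/dvdpP=> d ->; rewrite rmorphM /= pial mulr0.
move=> cal; rewrite /dvdp; apply: contraT => c0.
have: P (size (c %% pi)).
  apply/asboolP; exists (c %% pi); split=> //.
  have /(congr1 (base_eval iota al)) := divp_eq c pi.
  by rewrite rmorphD rmorphM /= pial mulr0 add0r cal.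
by move/minn; rewrite -szpi leqNgt ltn_modp pi0.
Qed.

Lemma size_point_min_poly (al : K') (pi : {poly K}) : pi != 0 ->
  (forall c, base_eval iota al c = 0 <-> pi %| c) -> (1 < size pi)%N.
Proof.
move=> pi0 piP; rewrite ltnNge; apply/negP => /size1_polyC piE.
have /piP := dvdpp pi; rewrite piE [base_eval _ _ _]horner_morphC.
by move/eqP; rewrite fmorph_eq0 => /eqP c0; rewrite piE c0 eqxx in pi0.
Qed.

End PointMinPoly.

Section ClearDenominators.
Variable R : idomainType.

Lemma fraction_numden (z : {fraction R}) :
  exists2 d : R, d != 0 & exists n : R, tofrac d * z = tofrac n.
Proof.
elim/quotW: z => x; exists x.2; first exact: denom_ratioP.
exists x.1; unlock tofrac; rewrite -[LHS]FracField.pi_mul.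
apply/eqmodP; rewrite /= FracField.equivfE /FracField.mulf.
by rewrite !numden_Ratio ?mulf_neq0 ?oner_eq0 ?denom_ratioP // mul1r mulr1 mulrC.
Qed.

Lemma poly_fraction_numden (p : {poly {fraction R}}) :
  exists2 d : R, d != 0 &
  exists H : {poly R}, tofrac d *: p = map_poly (@tofrac R) H.
Proof.
elim/poly_ind: p => [|p z [d d0 [H HE]]].
  by exists 1; rewrite ?oner_eq0 //; exists 0; rewrite scaler0 rmorph0.
have [e e0 [n nE]] := fraction_numden z.
exists (d * e); first exact: mulf_neq0.
exists (e *: H * 'X + (d * n)%:P).
have pE : tofrac (d * e) *: p = tofrac e *: map_poly (@tofrac R) H.
  by rewrite mulrC rmorphM /= -scalerA HE.
have zE : tofrac (d * e) * z = tofrac (d * n).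
  by rewrite !rmorphM /= -mulrA nE.
rewrite scalerDr scalerAl pE -[_ *: z%:P]mul_polyC -polyCM zE.
by rewrite rmorphD /= map_polyC /=; congr (_ + _); rewrite rmorphM /= map_polyZ map_polyX.
Qed.

End ClearDenominators.

Lemma dvdp_prod_XsubC_exp (K : fieldType) (s : seq K) (k : K -> nat) (c : {poly K}) :
  uniq s -> (forall a, a \in s -> ('X - a%:P) ^+ k a %| c) ->
  \prod_(a <- s) ('X - a%:P) ^+ k a %| c.
Proof.
elim: s => [|a s IH] /=; first by rewrite big_nil dvd1p.
case/andP=> nas us dv; rewrite big_cons Gauss_dvdp; last first.
  rewrite coprimep_expl // coprimep_sym coprimep_XsubC /root horner_prod prodf_seq_neq0.
  apply/allP => b bs /=; rewrite horner_exp hornerXsubC expf_neq0 // subr_eq0.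
  by apply: contraNneq nas => ->.
by rewrite dv ?mem_head // IH // => b bs; rewrite dv // inE bs orbT.
Qed.

Lemma size_prod_XsubC_exp (K : fieldType) (s : seq K) (k : K -> nat) :
  size (\prod_(a <- s) ('X - a%:P) ^+ k a) = (\sum_(a <- s) k a).+1.
Proof.
elim: s => [|a s IH]; first by rewrite !big_nil size_poly1.
rewrite !big_cons size_mul ?IH; last 2 first.
- by rewrite expf_neq0 // polyXsubC_eq0.
- by rewrite -size_poly_eq0 IH.
by rewrite size_exp_XsubC addSn addnS.
Qed.

Lemma monomial_rescale (R : comNzRingType) (x y t : R) (i j k l N : nat) :
  (k * i + l * j <= N)%N ->
  x ^+ i * y ^+ j * t ^+ N =
  (x * t ^+ k) ^+ i * (y * t ^+ l) ^+ j * t ^+ (N - (k * i + l * j)).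
Proof.
move=> le; rewrite -{1}(subnKC le) !exprMn -!exprM.
by rewrite [X in _ = X * _]mulrACA -exprD -[RHS]mulrA -exprD.
Qed.

(** * The curve L(Y) = w X ^ m and its weight function *)

(** The weights of X and Y are l and m = r l + 1.  Since m = 1 mod l, the weight
    of X^i Y^j with j < l determines j modulo l, hence i and j.  The root mu of
    w makes the leading terms Y^l and w X^m of the equation agree under the
    substitution [sigma] below. *)
Section Curve.
Variables (K : fieldType) (l r : nat) (L : {poly K}) (w mu : K).
Hypotheses (l_gt1 : (1 < l)%N) (monL : L \is monic) (szL : size L = l.+1).
Hypotheses (mu0 : mu != 0) (muw : mu ^+ l = w).
Local Notation m := (r * l).+1.
Local Notation R2 := {poly {poly K}}.
Local Notation Kx := {fraction {poly K}}.
Implicit Types f g a b s : R2.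

Definition curve_poly : R2 := map_poly polyC L - (w *: 'X^m)%:P.
Local Notation G := curve_poly.

Lemma size_polyC_L : size (map_poly polyC L) = l.+1.
Proof. by rewrite size_map_inj_poly ?szL //; apply: polyC_inj. Qed.

Lemma size_poly_tail : (size (- (w *: 'X^m)%:P : R2) < size (map_poly polyC L))%N.
Proof.
by rewrite size_polyC_L size_polyN ltnS (leq_trans (size_polyC_leq1 _)) // ltnW.
Qed.

Lemma size_curve_poly : size G = l.+1.
Proof. by rewrite size_polyDl ?size_poly_tail // size_polyC_L. Qed.

Lemma curve_poly_monic : G \is monic.
Proof.
rewrite monicE lead_coefDl ?size_poly_tail //.
by rewrite lead_coef_map_inj ?(monicP monL) //; apply: polyC_inj.
Qed.

(** Elements of K[x, y] are represented by polynomials of degree < l in Y, called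
    reduced. *)
Definition red f : R2 := f %% G.

Lemma red_eq f : f = (f %/ G) * G + red f.
Proof. exact: Pdiv.IdomainMonic.divp_eq curve_poly_monic f. Qed.

Lemma size_red f : (size (red f) <= l)%N.
Proof.
by rewrite -ltnS -size_curve_poly ltn_modp monic_neq0 ?curve_poly_monic.
Qed.

Lemma red_unique f u g : (size g <= l)%N -> f = u * G + g -> red f = g.
Proof.
move=> szg fE; apply/eqP; rewrite -subr_eq0.
have : red f - g = (u - f %/ G) * G.
  have E : f %/ G * G + red f = u * G + g by rewrite -red_eq.
  have -> : red f = u * G + g - f %/ G * G by rewrite -E addrAC subrr add0r.
  by rewrite addrAC addrK mulrBl.
move=> E; apply/eqP; case: (eqVneq (u - f %/ G) 0) => [E0|nz].
  by rewrite E E0 mul0r.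
have : (size (red f - g)%R <= l)%N.
  by rewrite (leq_trans (size_polyD _ _)) // geq_max size_polyN size_red.
rewrite E size_Mmonic ?curve_poly_monic // size_curve_poly addnS /=.
by rewrite -[X in (_ <= X)%N]add0n leq_add2r leqn0 size_poly_eq0 (negPf nz).
Qed.

Lemma red_id f : (size f <= l)%N -> red f = f.
Proof. by move=> szf; apply: (@red_unique _ 0) => //; rewrite mul0r add0r. Qed.

(** [filtered f W]: every monomial X^i Y^j of f has weight l i + m j <= W, for
    the weights that X and Y receive as pole orders at the point at infinity. *)
Definition filtered f (W : nat) :=
  forall i j, (W < l * i + m * j)%N -> f`_j`_i = 0.

Lemma filtered_mono f W W' : (W <= W')%N -> filtered f W -> filtered f W'.
Proof. by move=> le fW i j lt; apply: fW; apply: leq_ltn_trans lt. Qed.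

Lemma filteredD f g W : filtered f W -> filtered g W -> filtered (f + g) W.
Proof. by move=> fW gW i j lt; rewrite !coefD fW ?gW ?addr0. Qed.

Lemma filteredN f W : filtered f W -> filtered (- f) W.
Proof. by move=> fW i j lt; rewrite !coefN fW ?oppr0. Qed.

Lemma filteredM f g W V :
  filtered f W -> filtered g V -> filtered (f * g) (W + V).
Proof.
move=> fW gV i j lt; rewrite coefM coef_sum big1 // => -[a lta] _ /=.
rewrite coefM big1 // => -[c ltc] _ /=.
have [la|la] := ltnP W (l * c + m * a); first by rewrite fW ?mul0r.
rewrite gV ?mulr0 //.
have ai : (a <= j)%N by rewrite -ltnS.
have ci : (c <= i)%N by rewrite -ltnS.
rewrite !mulnBr.
have : (l * c <= l * i)%N by rewrite leq_mul2l ci orbT.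
have : (m * a <= m * j)%N by rewrite leq_mul2l ai orbT.
move: la lt; set A := (m * a)%N; set B := (m * j)%N.
set C := (l * c)%N; set D := (l * i)%N.
clear; lia.
Qed.

(** The substitution X = s^l, Y = mu s^m sends X^i Y^j to a monomial of degree
    its weight, and it kills the part of top weight of the curve equation. *)
Definition sigma : R2 -> {poly K} := eval2 (comp_poly 'X^l) (mu *: 'X^m).
HB.instance Definition _ := GRing.RMorphism.on sigma.
(** On reduced polynomials, the pole order at infinity. *)
Definition wt f := (size (sigma f)).-1.

Lemma sigma_sum n f : (size f <= n)%N ->
  sigma f = \sum_(j < n) mu ^+ j *: ((f`_j \Po 'X^l) * 'X^(m * j)).
Proof.
move=> szf; rewrite /sigma (eval2_sum _ _ szf); apply: eq_bigr => j _.
by rewrite exprZn -scalerAr exprM.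
Qed.

Lemma coef_sigma_term N j (c : {poly K}) :
  (mu ^+ j *: ((c \Po 'X^l) * 'X^(m * j)))`_N =
  if (m * j <= N)%N && (l %| N - m * j)%N
  then mu ^+ j * c`_((N - m * j) %/ l) else 0.
Proof.
rewrite coefZ coefMXn coef_comp_poly_Xn ?(ltnW l_gt1) //.
by rewrite ltnNge; case: (_ <= _)%N; case: (_ %| _)%N; rewrite ?mulr0.
Qed.

Lemma size_sigma f W : filtered f W -> (size (sigma f) <= W.+1)%N.
Proof.
move=> fW; apply/leq_sizeP => N ltN; rewrite (sigma_sum (leqnn _)) coef_sum.
rewrite big1 // => j _; rewrite coef_sigma_term; case: ifP => // /andP[mj dv].
by rewrite fW ?mulr0 // [(l * _)%N]mulnC divnK // subnK.
Qed.

Lemma wt_le f W : filtered f W -> (wt f <= W)%N.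
Proof. by move=> /size_sigma; rewrite /wt; case: (size _). Qed.

Lemma weight_modn i j : (j < l)%N -> ((l * i + m * j) %% l)%N = j.
Proof.
by move=> ltj; rewrite mulnC modnMDl mulSn mulnAC addnC modnMDl modn_small.
Qed.

Lemma weight_inj i j i' j' : (j < l)%N -> (j' < l)%N ->
  (l * i + m * j = l * i' + m * j')%N -> i = i' /\ j = j'.
Proof.
move=> ltj ltj' E; have Ej : j = j' by rewrite -(weight_modn i ltj) E weight_modn.
split=> //; move: E; rewrite Ej => /addIn /eqP.
by rewrite eqn_pmul2l ?(ltnW l_gt1) // => /eqP.
Qed.

(** Distinct monomials with j < l have distinct weights, so that no cancellation occurs
    when sigma is applied to a reduced polynomial. *)
Lemma coef_sigma f i j : (size f <= l)%N -> (j < l)%N ->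
  (sigma f)`_(l * i + m * j) = mu ^+ j * f`_j`_i.
Proof.
move=> szf ltj; have l0 := ltnW l_gt1.
rewrite (sigma_sum szf) coef_sum (bigD1 (Ordinal ltj)) //= coef_sigma_term.
rewrite addnK leq_addl dvdn_mulr //= mulKn // big1 ?addr0 // => k.
rewrite -val_eqE /= => nkj; rewrite coef_sigma_term; case: ifP => // /andP[le].
rewrite -eqn_mod_dvd // weight_modn // => /eqP.
have := weight_modn 0 (ltn_ord k); rewrite muln0 add0n => -> E'.
by rewrite E' eqxx in nkj.
Qed.

Lemma filtered_sigma f W :
  (size f <= l)%N -> (size (sigma f) <= W.+1)%N -> filtered f W.
Proof.
move=> szf szs i j lt; have [ltj|lej] := ltnP j l; last first.
  by rewrite (nth_default _ (leq_trans szf lej)) coef0.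
have := coef_sigma i szf ltj; rewrite nth_default; last exact: leq_trans lt.
by move/eqP; rewrite eq_sym mulf_eq0 expf_eq0 (negPf mu0) andbF => /eqP.
Qed.

Lemma filtered_wt f : (size f <= l)%N -> filtered f (wt f).
Proof. by move=> szf; apply: filtered_sigma => //; apply: leqSpred. Qed.

Lemma sigma_eq0 f : (size f <= l)%N -> (sigma f == 0) = (f == 0).
Proof.
move=> szf; apply/eqP/eqP => [s0|->]; last by rewrite rmorph0.
apply/polyP => j; apply/polyP => i; rewrite !coef0.
have [ltj|lej] := ltnP j l; last first.
  by rewrite (nth_default _ (leq_trans szf lej)) coef0.
have := coef_sigma i szf ltj; rewrite s0 coef0.
by move/eqP; rewrite eq_sym mulf_eq0 expf_eq0 (negPf mu0) andbF => /eqP.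
Qed.

Lemma filtered_curve : filtered G (l * m).
Proof.
move=> i [|j] lt; rewrite coefB coef_map !coefC /=.
  have i_gt : (m < i)%N by rewrite muln0 addn0 ltn_mul2l in lt; case/andP: lt.
  rewrite coefB coefZ coefXn (gtn_eqF i_gt) mulr0 subr0 coefC.
  by case: i i_gt {lt}.
rewrite subr0 coefC; case: eqP => // i0; rewrite i0 muln0 add0n mulnC in lt.
by rewrite nth_default // szL; rewrite ltn_mul2l in lt; case/andP: lt.
Qed.

Lemma sigma_curve : (size (sigma G) <= l * m)%N.
Proof.
apply/leq_sizeP => N; rewrite leq_eqVlt => /orP[/eqP<-|]; last first.
  by move=> lt; apply/leq_sizeP: lt; apply: size_sigma filtered_curve.
rewrite rmorphB /= [sigma _%:P]eval2C /= linearZ /= rmorphXn /= comp_polyX.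
rewrite coefB coefZ -exprM coefXn eqxx mulr1.
have sz : (size (map_poly polyC L) <= l.+1)%N by rewrite -szL size_poly.
rewrite (sigma_sum sz) coef_sum big_ord_recr /= big1 ?add0r.
  rewrite coefZ coef_map /= comp_polyC coefCM coefXn mulnC eqxx mulr1.
  by move/monicP: monL; rewrite lead_coefE szL /= => ->; rewrite mulr1 muw subrr.
move=> j _; rewrite coefZ coef_map /= comp_polyC coefCM coefXn.
by rewrite mulnC eqn_pmul2l // gtn_eqF ?mulr0.
Qed.

(** Reduction modulo the curve equation preserves the part of weight W as it
    is seen by sigma: each step trades a monomial for one of equal weight with
    the same image, up to lower terms. *)
Lemma filtered_red f W :
  filtered f W -> filtered (red f) W /\ (sigma (red f))`_W = (sigma f)`_W.
Proof.
have [n] := ubnP (size f); elim: n => // n IHn in f *; rewrite ltnS => lefn fW.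
have [szf|szf] := leqP (size f) l; first by rewrite red_id.
pose d := (size f).-1; have szfE : size f = d.+1 by rewrite /d (ltn_predK szf).
have led : (l <= d)%N by rewrite -ltnS -szfE.
pose u : R2 := (lead_coef f)%:P * 'X^(d - l).
have f0 : f != 0 by rewrite -size_poly_gt0 szfE.
have szu : size u = (d - l).+1 by rewrite size_Cmul ?size_polyXn ?lead_coef_eq0.
have leadu : lead_coef u = lead_coef f by rewrite lead_coefM lead_coefC lead_coefXn mulr1.
have Wd : (m * d <= W)%N.
  rewrite leqNgt; apply: contra f0 => lt; rewrite -lead_coef_eq0 lead_coefE -/d.
  by apply/eqP/polyP => i; rewrite coef0 fW // (leq_trans lt) ?leq_addl.
have Wl : (l * m <= W)%N by apply: leq_trans Wd; rewrite mulnC leq_mul2l led orbT.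
have uW : filtered u (W - l * m).
  move=> i j lt; rewrite coefCM coefXn; have [ej|nj] := eqVneq j (d - l)%N; last first.
    by rewrite mulr0 coef0.
  rewrite mulr1 lead_coefE -/d fW //; move: lt; rewrite ej ltn_subLR //.
  by rewrite addnCA [(l * m)%N]mulnC -mulnDr subnKC.
have szuG : size (u * G) = d.+1.
  rewrite size_Mmonic ?curve_poly_monic //; last by rewrite -size_poly_gt0 szu.
  by rewrite size_curve_poly szu addnS /= addSn subnK.
have ltf' : (size (f - u * G)%R < n)%N.
  apply: leq_trans lefn; rewrite szfE ltnS; apply/leq_sizeP => j.
  rewrite leq_eqVlt => /orP[/eqP<-|lt]; last first.
    by rewrite coefB !nth_default ?subr0 // ?szfE ?szuG.
  rewrite coefB {1}/d -lead_coefE.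
  have -> : d = (size (u * G)%R).-1 by rewrite szuG.
  rewrite -lead_coefE lead_coef_Mmonic ?curve_poly_monic // leadu subrr //.
have uGW : filtered (u * G) W.
  by rewrite -(subnK Wl); apply: filteredM uW filtered_curve.
have [] := IHn (f - u * G) ltf' (filteredD fW (filteredN uGW)).
have -> : red (f - u * G) = red f.
  apply: (@red_unique _ (f %/ G - u)); first exact: size_red.
  by rewrite mulrBl addrAC -red_eq.
move=> rW ->; split=> //; rewrite rmorphB rmorphM /= coefB.
rewrite [X in _ - X]nth_default ?subr0 //.
apply: leq_trans (size_polyMleq _ _) _.
have l0m : (0 < l * m)%N by rewrite muln_gt0 (ltnW l_gt1).
have := size_sigma uW; have := sigma_curve.
by move: Wl; move: (size _) (size _) (l * m)%N l0m => a b c; lia.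
Qed.

Lemma wt_lead f : (size f <= l)%N -> f != 0 -> (sigma f)`_(wt f) != 0.
Proof. by move=> szf f0; rewrite -lead_coefE lead_coef_eq0 sigma_eq0. Qed.

Lemma wt_attained f : (size f <= l)%N -> f != 0 ->
  exists i j, [/\ (j < l)%N, f`_j`_i != 0 & (l * i + m * j)%N = wt f].
Proof.
move=> szf f0; have := wt_lead szf f0; rewrite (sigma_sum szf) coef_sum.
case: (pickP (fun j : 'I_l => (mu ^+ j *: ((f`_j \Po 'X^l) * 'X^(m * j)))`_(wt f) != 0)).
  move=> j + _; rewrite coef_sigma_term.
  case: ifP => [/andP[le dv]|]; last by rewrite eqxx.
  rewrite mulf_eq0 negb_or => /andP[_ fj].
  by exists ((wt f - m * j) %/ l)%N, j; rewrite ltn_ord [(l * _)%N]mulnC divnK // subnK.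
by move=> all0; rewrite big1 ?eqxx // => j _; apply/eqP; have /negbFE := all0 j.
Qed.

(** The leading terms of sigma f and sigma g multiply to the term of degree
    wt f + wt g, which survives reduction by [filtered_red]. *)
Lemma wt_redM f g : (size f <= l)%N -> (size g <= l)%N -> f != 0 -> g != 0 ->
  red (f * g) != 0 /\ wt (red (f * g)) = (wt f + wt g)%N.
Proof.
move=> szf szg f0 g0.
have [rW rc] := filtered_red (filteredM (filtered_wt szf) (filtered_wt szg)).
have sf0 : sigma f != 0 by rewrite sigma_eq0.
have sg0 : sigma g != 0 by rewrite sigma_eq0.
have nz : (sigma (red (f * g)))`_(wt f + wt g) != 0.
  rewrite rc rmorphM /=.
  have -> : (wt f + wt g)%N = (size (sigma f * sigma g)).-1.
    rewrite size_mul // /wt; move: sf0 sg0; rewrite -!size_poly_gt0.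
    by move: (size _) (size _) => a b; lia.
  by rewrite -lead_coefE lead_coef_eq0 mulf_neq0.
split; first by apply: contraNneq nz => ->; rewrite rmorph0 coef0.
apply/eqP; rewrite eqn_leq wt_le //= /wt -ltnS.
rewrite (leq_trans _ (leqSpred _)) // ltnNge; apply: contra nz => /leq_sizeP-> //.
Qed.

Lemma wtD f g k : (wt f <= k)%N -> (wt g <= k)%N -> (wt (f + g) <= k)%N.
Proof.
rewrite /wt rmorphD /= => a b; have := size_polyD (sigma f) (sigma g).
by move: a b; move: (size _) (size _) (size _) => x y z; clear; lia.
Qed.

Lemma wtC c : wt c%:P = (l * (size c).-1)%N.
Proof. by rewrite /wt [sigma _]eval2C /= size_comp_poly size_polyXn mulnC. Qed.

Lemma wtX : wt 'X = m.
Proof. by rewrite /wt [sigma _]eval2X size_scale // size_polyXn. Qed.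

(** * The function field of the curve *)

(** A factorisation over K(x) becomes, after clearing denominators, a relation
    J * H = c G with J, H reduced and nonzero, so that the reduction of J * H
    vanishes: this contradicts the multiplicativity of the weight. *)
Lemma curve_poly_irreducible : irreducible_poly (map_poly (@tofrac {poly K}) G).
Proof.
have tinj : injective (@tofrac {poly K}).
  by move=> a b /eqP; rewrite tofrac_eq => /eqP.
have szt (p : R2) : size (map_poly (@tofrac {poly K}) p) = size p.
  by rewrite size_map_inj_poly ?rmorph0.
have szG := size_curve_poly.
split=> [|q q1 /dvdpP[s sE]]; first by rewrite szt szG ltnS ltnW.
have szqs : size (s * q) = l.+1 by rewrite -sE szt szG.
have qs0 : s * q != 0 by rewrite -size_poly_eq0 szqs.
move: (qs0); rewrite mulf_eq0 negb_or => /andP[s0 q0].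
rewrite -dvdp_size_eqp; last by rewrite sE dvdp_mull.
rewrite szt szG.
have szM : (size s + size q = l.+2)%N.
  move: szqs; rewrite size_mul //; move: s0; rewrite -size_poly_gt0.
  by case: (size s) => //= n _; rewrite addSn => ->.
have [d d0 [H HE]] := poly_fraction_numden q.
have [e e0 [J JE]] := poly_fraction_numden s.
have szH : size H = size q.
  by rewrite -szt -HE size_scale // tofrac_eq0.
have szJ : size J = size s.
  by rewrite -szt -JE size_scale // tofrac_eq0.
rewrite eqn_leq; apply/andP; split.
  by rewrite -ltnS -szM -{1}[size q]add0n ltn_add2r size_poly_gt0.
rewrite leqNgt ltnS; apply/negP => leql.
have lesl : (size s <= l)%N.
  have q2 : (1 < size q)%N by rewrite ltn_neqAle eq_sym q1 size_poly_gt0.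
  by rewrite -(leq_add2r 2) [(l + 2)%N]addn2 -szM leq_add2l.
have H0 : H != 0 by rewrite -size_poly_gt0 szH size_poly_gt0.
have J0 : J != 0 by rewrite -size_poly_gt0 szJ size_poly_gt0.
rewrite -szH in leql; rewrite -szJ in lesl.
have [+ _] := wt_redM lesl leql J0 H0.
have JH : J * H = (e * d)%:P * G.
  apply: (map_inj_poly tinj); rewrite ?rmorph0 // rmorphM /= -HE -JE.
  rewrite [RHS]rmorphM /= sE map_polyC /= tofracM mul_polyC.
  by rewrite -scalerAl -scalerAr scalerA.
rewrite (@red_unique _ (e * d)%:P 0) ?eqxx ?size_poly0 //.
by rewrite addr0.
Qed.

(** The element c(x) of F. *)
Definition xeval (F : fieldExtType Kx) : {poly K} -> F := in_alg F \o (@tofrac {poly K}).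
HB.instance Definition _ F := GRing.RMorphism.on (xeval F).

Definition curve_field (F : fieldExtType Kx) (y : F) :=
  [/\ \dim {:F} = l, eval2 (xeval F) y G = 0 & <<1; y>>%VS = fullv].

Lemma curve_field_exists : exists F y, @curve_field F y.
Proof.
have irr := curve_poly_irreducible.
have [F dimF [y ry gen]] := irredp_FAdjoin irr.
exists F, y; split=> //.
  rewrite dimF size_map_inj_poly ?rmorph0 // ?size_curve_poly //.
  by move=> a b /eqP; rewrite tofrac_eq => /eqP.
by move: ry; rewrite -map_poly_comp => /rootP.
Qed.

Variables (F : fieldExtType Kx) (y : F).

Lemma xevalM c d : xeval F (c * d) = xeval F c * xeval F d. Proof. exact: rmorphM. Qed.
Lemma xevalB c d : xeval F (c - d) = xeval F c - xeval F d. Proof. exact: rmorphB. Qed.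
Lemma xevalX c n : xeval F (c ^+ n) = xeval F c ^+ n. Proof. exact: rmorphXn. Qed.
Lemma xevalC c : xeval F c%:P = kconst F c. Proof. by []. Qed.
Lemma xeval_eq0 c : (xeval F c == 0) = (c == 0).
Proof. by rewrite /xeval /= scaler_eq0 oner_eq0 orbF tofrac_eq0. Qed.

Hypothesis Fy : curve_field y.

(** The element f(x, y) of F. *)
Definition ev_at : R2 -> F := eval2 (xeval F) y.
HB.instance Definition _ := GRing.RMorphism.on ev_at.
Local Notation ev := ev_at.

Lemma evM f g : ev (f * g) = ev f * ev g. Proof. exact: rmorphM. Qed.

Lemma evD f g : ev (f + g) = ev f + ev g. Proof. exact: rmorphD. Qed.
Lemma evB f g : ev (f - g) = ev f - ev g. Proof. exact: rmorphB. Qed.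
Lemma evX f n : ev (f ^+ n) = ev f ^+ n. Proof. exact: rmorphXn. Qed.
Lemma ev0 : ev 0 = 0. Proof. exact: rmorph0. Qed.
Lemma ev1 : ev 1 = 1. Proof. exact: rmorph1. Qed.

Lemma ev_const c : ev c%:P%:P = kconst F c.
Proof. exact: eval2C. Qed.

Lemma ev_red f : ev (red f) = ev f.
Proof.
rewrite [in RHS](red_eq f) rmorphD rmorphM /=.
by case: Fy => _ Gy _; rewrite [ev G]Gy mulr0 add0r.
Qed.

(** The minimal polynomial of y over K(x) has degree l. *)
Lemma ev_eq0 f : (size f <= l)%N -> (ev f == 0) = (f == 0).
Proof.
move=> szf; apply/eqP/eqP => [f0|->]; last by rewrite rmorph0.
have kx_inj : injective (xeval F).
  by move=> a b E; apply/eqP; rewrite -subr_eq0 -xeval_eq0 xevalB E subrr.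
have szm : size (minPoly 1 y) = l.+1.
  case: Fy => dimF _ gen; rewrite size_minPoly -dimF -gen.
  by rewrite [\dim _](dim_Fadjoin 1) dimv1 muln1.
have /minPoly_dvdp : map_poly (xeval F) f \is a polyOver 1%VS.
  by apply/polyOverP => i; rewrite coef_map /= rpredZ ?mem1v.
move=> /(_ y); rewrite rootE => /(_ (introT eqP f0)).
apply: contraTeq => nf0; rewrite gtNdvdp //.
  by rewrite -size_poly_gt0 size_map_inj_poly ?rmorph0 // size_poly_gt0.
by rewrite size_map_inj_poly ?rmorph0 // szm.
Qed.

Lemma evC c : ev c%:P = xeval F c. Proof. exact: eval2C. Qed.

(** In the basis 1, y, ..., y^(l - 1) of F over K(x), a common denominator of the
    coordinates of z. *)
Lemma ev_frac (z : F) :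
  exists2 c : {poly K}, c != 0 &
  exists2 a : R2, (size a <= l)%N & xeval F c * z = ev a.
Proof.
case: Fy => dimF Gy gen.
have /Fadjoin_poly_eq zE : z \in <<1; y>>%VS by rewrite gen memvf.
have /polyOver1P[p pE] := Fadjoin_polyOver 1 y z.
have [c c0 [H HE]] := poly_fraction_numden p.
exists c => //; exists (red H); first exact: size_red.
rewrite ev_red -zE pE /ev_at /eval2 /horner_morph [xeval F]lock -lock map_poly_comp -HE.
by rewrite map_polyZ hornerZ.
Qed.

(** * The place at infinity *)

Section InfinitePlace.

Lemma w_neq0 : w != 0. Proof. by rewrite -muw expf_neq0. Qed.

(** The order n of z at infinity, as a relation: a quotient of reduced functions has the
    difference of their weights as its order. *)
Definition inf_ord (z : F) (n : int) : Prop := exists f g,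
  [/\ (size f <= l)%N, (size g <= l)%N, f != 0, g != 0 &
      z = ev f / ev g /\ n = (wt g)%:Z - (wt f)%:Z].

Lemma ev_neq0 f : (size f <= l)%N -> f != 0 -> ev f != 0.
Proof. by move=> szf; rewrite ev_eq0. Qed.

Lemma inf_ord_neq0 z n : inf_ord z n -> z != 0.
Proof. by case=> f [g [? ? ? ? [-> _]]]; rewrite mulf_neq0 ?invr_eq0 ?ev_neq0. Qed.

Lemma inf_ord_uniq z n n' : inf_ord z n -> inf_ord z n' -> n = n'.
Proof.
case=> f [g [sf sg f0 g0 [-> ->]]] [f' [g' [sf' sg' f'0 g'0 [+ ->]]]].
move/eqP; rewrite eqr_div ?ev_neq0 // -!evM.
rewrite -ev_red -[X in _ == X]ev_red.
rewrite -subr_eq0 -evB ev_eq0 ?subr_eq0 => [/eqP E|]; last first.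
  by rewrite (leq_trans (size_polyD _ _)) // size_polyN geq_max !size_red.
have [_] := wt_redM sf sg' f0 g'0.
have [_] := wt_redM sf' sg f'0 g0.
rewrite E => -> E'; have : ((wt f' + wt g)%N%:Z = (wt f + wt g')%N%:Z) by rewrite E'.
by rewrite !PoszD; lia.
Qed.

Lemma inf_ord_ev f : (size f <= l)%N -> f != 0 -> inf_ord (ev f) (- (wt f)%:Z).
Proof.
move=> sf f0; exists f, 1; rewrite size_poly1 oner_neq0 ev1 divr1; split=> //.
  exact: ltnW.
by split=> //; rewrite -polyC1 wtC // size_poly1 muln0 sub0r.
Qed.

Lemma inf_ordM z z' n n' :
  inf_ord z n -> inf_ord z' n' -> inf_ord (z * z') (n + n').
Proof.
case=> f [g [sf sg f0 g0 [-> ->]]] [f' [g' [sf' sg' f'0 g'0 [-> ->]]]].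
have [nf wf] := wt_redM sf sf' f0 f'0.
have [ng wg] := wt_redM sg sg' g0 g'0.
exists (red (f * f')), (red (g * g')); split=> //; try exact: size_red.
rewrite !ev_red !evM mulf_div wf wg; split=> //.
by rewrite !PoszD; lia.
Qed.

Lemma inf_ordV z n : inf_ord z n -> inf_ord z^-1 (- n).
Proof.
case=> f [g [sf sg f0 g0 [-> ->]]]; exists g, f; split=> //.
by rewrite invf_div opprB.
Qed.

Lemma inf_ord_total z : z != 0 -> exists n, inf_ord z n.
Proof.
move=> z0; have [c c0 [a sa aE]] := ev_frac z.
have c0' : xeval F c != 0 by rewrite xeval_eq0.
have a0 : a != 0.
  by rewrite -ev_eq0 // -aE mulf_neq0.
have an := inf_ord_ev sa a0.
have szc : (size (c%:P : R2) <= l)%N by rewrite (leq_trans (size_polyC_leq1 _)) // ltnW.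
have cn := inf_ord_ev szc (_ : c%:P != 0); rewrite polyC_eq0 in cn.
eexists; rewrite -(mulKf c0' z) aE -evC.
exact: inf_ordM (inf_ordV (cn c0)) an.
Qed.

Definition inf_val (z : F) : int := xget 0 [set n | inf_ord z n]%classic.

Lemma inf_valE z n : inf_ord z n -> inf_val z = n.
Proof.
move=> zn; rewrite /inf_val; case: xgetP => [k _ zk|/(_ n) //].
exact: inf_ord_uniq zk zn.
Qed.

Lemma inf_val_ord z : z != 0 -> inf_ord z (inf_val z).
Proof. by move=> /inf_ord_total[n zn]; rewrite (inf_valE zn). Qed.

(** Its order is 1, because m = r l + 1. *)
Definition inf_uniformizer : F := xeval F 'X ^+ r / y.
Local Notation t := inf_uniformizer.

Lemma evY : ev 'X = y. Proof. exact: eval2X. Qed.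

Lemma inf_ord_uniformizer : inf_ord t 1.
Proof.
have sC : (size (('X^r : {poly K})%:P : R2) <= l)%N.
  by rewrite (leq_trans (size_polyC_leq1 _)) // ltnW.
exists ('X^r)%:P, 'X; rewrite size_polyX polyX_eq0 polyC_eq0 -size_poly_eq0 size_polyXn.
split=> //; rewrite evC evY xevalX wtX // wtC // size_polyXn; split=> //=.
by rewrite mulnC -addn1 PoszD; lia.
Qed.

Lemma inf_valP : discrete_valuation inf_val t.
Proof.
split.
- exact: inf_ord_neq0 inf_ord_uniformizer.
- exact: inf_valE inf_ord_uniformizer.
- move=> c c0; apply: inf_valE; rewrite -ev_const.
  have := @inf_ord_ev c%:P%:P; rewrite !polyC_eq0 wtC // => H.
  have -> : 0 = - (l * (size c%:P).-1)%N%:Z by rewrite size_polyC c0 muln0.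
  apply: H => //; rewrite (leq_trans (size_polyC_leq1 _)) //; exact: ltnW.
- move=> z z' z0 z'0; apply: inf_valE.
  exact: inf_ordM (inf_val_ord z0) (inf_val_ord z'0).
move=> k z z' z0 z'0 zz'0.
have [f [g [sf sg f0 g0 []]]] := inf_val_ord z0.
have [f' [g' [sf' sg' f'0 g'0 []]]] := inf_val_ord z'0.
set n := inf_val z; set n' := inf_val z' => z'E n'E zE nE kn kn'.
have [nfg' wfg'] := wt_redM sf sg' f0 g'0.
have [nf'g wf'g] := wt_redM sf' sg f'0 g0.
have [ngg' wgg'] := wt_redM sg sg' g0 g'0.
pose h := red (f * g') + red (f' * g).
have sh : (size h <= l)%N.
  by rewrite (leq_trans (size_polyD _ _)) // geq_max !size_red.
have E : z + z' = ev h / ev (red (g * g')).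
  rewrite zE z'E addf_div ?ev_neq0 // evD !ev_red !evM.
  by [].
have h0 : h != 0 by apply: contraNneq zz'0 => h0; rewrite E h0 ev0 mul0r.
have -> : inf_val (z + z') = (wt (red (g * g')))%:Z - (wt h)%:Z.
  by apply: inf_valE; exists h, (red (g * g')); split=> //; apply: size_red.
have : (wt h <= maxn (wt f + wt g') (wt f' + wt g))%N.
  by rewrite /h; apply: wtD; rewrite ?wfg' ?wf'g ?leq_maxl ?leq_maxr.
move: kn kn'; rewrite nE n'E wgg' !PoszD.
move: (wt h) (wt f) (wt g) (wt f') (wt g'); clear; lia.
Qed.

Definition inf_place : place F := dval_place inf_valP.

Lemma inf_place_valuation f : (size f <= l)%N -> f != 0 ->
  valuation inf_place (ev f) = - (wt f)%:Z.
Proof.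
move=> sf f0; rewrite dval_place_valuation ?ev_neq0 //.
by apply: inf_valE; apply: inf_ord_ev.
Qed.

Lemma inf_place_X : xeval F 'X \notin place_ring inf_place.
Proof.
have sC : (size (('X : {poly K})%:P : R2) <= l)%N.
  by rewrite (leq_trans (size_polyC_leq1 _)) // ltnW.
have X0 : ('X : {poly K})%:P != 0 :> R2 by rewrite polyC_eq0 polyX_eq0.
rewrite -evC dval_place_ring ?ev_neq0 // (inf_valE (inf_ord_ev sC X0)).
by rewrite wtC // size_polyX /= muln1 -ltNge; lia.
Qed.

Section OtherPlaces.
Variable P : place F.
Local Notation O := (place_ring P).
Local Notation x := (xeval F 'X).

Lemma curve_eq : \sum_(j < l.+1) kconst F L`_j * y ^+ j = kconst F w * x ^+ m.
Proof.
have /eqP : ev G = 0 by case: Fy.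
rewrite evB subr_eq0 evC => /eqP.
have sz : (size (map_poly polyC L) <= l.+1)%N by rewrite -szL size_poly.
rewrite {1}/ev_at (eval2_sum _ _ sz) => E.
transitivity (\sum_(j < l.+1) xeval F (map_poly polyC L)`_j * y ^+ j).
  by apply: eq_bigr => j _; rewrite coef_map.
by rewrite E -mul_polyC xevalM xevalX.
Qed.

(** The curve equation is an integral equation for y over K[x]. *)
Lemma place_ring_Y : x \in O -> y \in O.
Proof.
move=> Ox; pose p := map_poly (kconst F) L - (kconst F w * x ^+ m)%:P.
have lt : (size (- (kconst F w * x ^+ m)%:P : {poly F}) < size (map_poly (kconst F) L))%N.
  rewrite size_map_poly szL size_polyN ltnS (leq_trans (size_polyC_leq1 _)) //.
  exact: ltnW.
apply: (@place_ring_integral _ _ P p).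
- by rewrite monicE lead_coefDl // lead_coef_map (monicP monL) rmorph1.
- move=> i; rewrite coefB coef_map coefC place_ringB ?place_ring_const //.
  by case: ifP; rewrite ?place_ring0 // place_ringM ?place_ring_const ?place_ringX.
apply/rootP; rewrite hornerD hornerN hornerC horner_coef size_map_poly szL.
apply/eqP; rewrite subr_eq0 -curve_eq; apply/eqP; apply: eq_bigr => j _.
by rewrite coef_map.
Qed.

Lemma xeval_sum (c : {poly K}) n : (size c <= n)%N ->
  xeval F c = \sum_(i < n) kconst F c`_i * x ^+ i.
Proof.
move=> szc; have {1}-> : c = \sum_(i < n) (c`_i)%:P * 'X^i.
  rewrite -[LHS](_ : \poly_(i < n) c`_i = c).
    by rewrite poly_def; apply: eq_bigr => i _; rewrite mul_polyC.
  apply/polyP => i; rewrite coef_poly; case: ltnP => // le.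
  by rewrite nth_default // (leq_trans szc).
by rewrite [LHS]rmorph_sum; apply: eq_bigr => i _; rewrite [LHS]xevalM xevalX.
Qed.

Hypothesis nOx : x \notin O.

Lemma pole_Xinv : x^-1 \in place_ideal P.
Proof.
have x0 : x != 0 by apply: contraNneq nOx => ->; apply: place_ring0.
by rewrite place_idealE ?invr_eq0 // invrK.
Qed.

Lemma pole_X0 : x != 0.
Proof. by apply: contraNneq nOx => ->; apply: place_ring0. Qed.

(** Otherwise x ^ m, and with it x, would be regular. *)
Lemma pole_Y : y \notin O.
Proof.
apply: contra nOx => Oy; have x0 := pole_X0.
have : kconst F w * x ^+ m \in O.
  rewrite -curve_eq place_ring_sum // => j _.
  by rewrite place_ringM ?place_ring_const ?place_ringX.
have kw : kconst F w != 0 by rewrite fmorph_eq0 w_neq0.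
move/(place_ringM (place_ring_const P w^-1)).
rewrite mulrA -rmorphM mulVf ?w_neq0 // rmorph1 mul1r exprSr => Oxm.
have Ox' := place_ideal_ring pole_Xinv.
have : x ^+ (r * l) * x * (x^-1) ^+ (r * l) \in O by rewrite place_ringM ?place_ringX.
by rewrite mulrAC -exprMn divff // expr1n mul1r.
Qed.

Lemma pole_Y0 : y != 0.
Proof. by apply: contraNneq pole_Y => ->; apply: place_ring0. Qed.

Lemma pole_Yinv : y^-1 \in place_ideal P.
Proof. by rewrite place_idealE ?invr_eq0 ?pole_Y0 // invrK pole_Y. Qed.

(** At a pole of x the curve equation reads y ^ l * unit = w x ^ m, so that
    x t ^ l and y t ^ m are units for t = x ^ r / y. *)
Lemma pole_unit_XY :
  [/\ t \in place_ideal P, x * t ^+ l \in place_unit P & y * t ^+ m \in place_unit P].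
Proof.
have [x0 y0] := (pole_X0, pole_Y0); have l0 := ltnW l_gt1.
have kw : kconst F w \in place_unit P by rewrite place_unit_const ?w_neq0.
have kw0 := place_unit_neq0 kw.
pose U := kconst F w * x ^+ m / y ^+ l.
have UU : U \in place_unit P.
  rewrite /U -curve_eq big_ord_recr /= mulrDl.
  have -> : L`_l = 1 by move/monicP: monL; rewrite lead_coefE szL.
  rewrite rmorph1 mul1r divff ?expf_neq0 // addrC place_unitD ?place_unit1 //.
  rewrite mulr_suml place_ideal_sum // => j _.
  rewrite -mulrA mulrC place_idealM ?place_ring_const //.
  rewrite -[X in _ / y ^+ X](subnKC (ltnW (ltn_ord j))) exprD invfM mulrA.
  rewrite divff ?expf_neq0 // mul1r -exprVn place_idealX ?pole_Yinv //.
  by rewrite subn_gt0.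
have xtl : x * t ^+ l = U / kconst F w.
  rewrite /inf_uniformizer expr_div_n -exprM mulrA -exprS /U.
  by rewrite [RHS]mulrAC [X in _ = X / _]mulrAC divff // mul1r.
have Uxtl : x * t ^+ l \in place_unit P.
  by rewrite xtl place_unitM ?place_unitV.
have t0 : t != 0 by rewrite mulf_neq0 ?expf_neq0 ?invr_eq0.
split=> //; last first.
  have -> : y * t ^+ m = (x * t ^+ l) ^+ r.
    rewrite [RHS]exprMn -exprM [(l * r)%N]mulnC exprS mulrA; congr (_ * _).
    by rewrite mulrC divfK.
  exact: place_unitX.
apply: (@place_idealX_rad _ _ _ _ l).
rewrite -(mulKf x0 (t ^+ l)) place_idealM ?pole_Xinv //.
exact: place_unit_ring.
Qed.

(** In a reduced polynomial a single monomial has the top weight, hence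
    dominates all the others at a pole of x. *)
Lemma pole_unit_ev f : (size f <= l)%N -> f != 0 ->
  ev f * t ^+ wt f \in place_unit P.
Proof.
move=> sf f0; set W := wt f; have [Pt Ux Uy] := pole_unit_XY.
have fW : filtered f W by apply: filtered_wt.
have l0 := ltnW l_gt1.
have [ij0 fij0 ij0W] : exists2 ij : 'I_W.+1 * 'I_l,
    f`_ij.2`_ij.1 != 0 & (l * ij.1 + m * ij.2 = W)%N.
  have [i [j [ltj fij ijW]]] := wt_attained sf f0.
  have lti : (i < W.+1)%N.
    by rewrite ltnS /W -ijW (leq_trans _ (leq_addr _ _)) // leq_pmull.
  by exists (Ordinal lti, Ordinal ltj).
have -> : ev f * t ^+ W = \sum_(ij : 'I_W.+1 * 'I_l)
    kconst F f`_ij.2`_ij.1 * (x ^+ ij.1 * y ^+ ij.2 * t ^+ W).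
  rewrite -(pair_bigA _ (fun (i : 'I_W.+1) (j : 'I_l) =>
    kconst F f`_j`_i * (x ^+ i * y ^+ j * t ^+ W))) /=.
  rewrite exchange_big /= {1}/ev_at (eval2_sum _ _ sf) mulr_suml; apply: eq_bigr => j _.
  transitivity (xeval F f`_j * y ^+ j * t ^+ W); first by [].
  rewrite (@xeval_sum f`_j W.+1); last first.
    apply/leq_sizeP => i lti; apply: (fW i j).
    by rewrite (leq_trans lti) // (leq_trans _ (leq_addr _ _)) // leq_pmull.
  by rewrite !mulr_suml; apply: eq_bigr => i _; rewrite !mulrA.
have E (i j : nat) : (l * i + m * j <= W)%N ->
  x ^+ i * y ^+ j * t ^+ W =
  (x * t ^+ l) ^+ i * (y * t ^+ m) ^+ j * t ^+ (W - (l * i + m * j)).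
  exact: monomial_rescale.
rewrite (bigD1 ij0) //= place_unitD //.
  rewrite E ij0W // subnn expr0 mulr1.
  by rewrite !place_unitM ?place_unitX ?place_unit_const.
apply: place_ideal_sum => -[i j] /= nij.
have [->|fij] := eqVneq (f`_j`_i) 0; first by rewrite rmorph0 mul0r place_ideal0.
have le : (l * i + m * j <= W)%N.
  by rewrite leqNgt; apply: contra fij => lt; rewrite (fW i j lt).
rewrite mulrC place_idealM ?place_ring_const // E // mulrC place_idealM //.
  rewrite place_idealX // subn_gt0 ltn_neqAle le andbT.
  apply: contra nij => /eqP ijW.
  have [Ei Ej] := weight_inj (ltn_ord j) (ltn_ord ij0.2) (etrans ijW (esym ij0W)).
  by apply/eqP; case: ij0 Ei Ej {fij0 ij0W ijW} => i0 j0 /= /val_inj-> /val_inj->.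
by rewrite place_ringM ?place_ringX ?place_unit_ring.
Qed.

(** By [pole_unit_ev], every nonzero z is t ^ n times a unit of the place, n being its
    order at infinity; so z is regular at the place exactly when n >= 0. *)
Lemma place_of_pole_X : P = inf_place.
Proof.
have [Pt _ _] := pole_unit_XY; have t0 := dval_t0 inf_valP.
apply: place_eqP => z; change ((z \in O) = (z \in place_ring inf_place)).
have [->|z0] := eqVneq z 0; first by rewrite !place_ring0.
rewrite dval_place_ring //.
have [f [g [sf sg f0 g0 [zE ->]]]] := inf_val_ord z0.
pose u := (ev f * t ^+ wt f) / (ev g * t ^+ wt g).
have Uu : u \in place_unit P by rewrite place_unitM ?place_unitV ?pole_unit_ev.
have {zE} zE : z * t ^+ wt f = u * t ^+ wt g.
  rewrite /u invfM mulrA divfK ?expf_neq0 // zE mulrAC.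
  by rewrite mulrAC.
rewrite subr_ge0 lez_nat; case: leqP => le.
  have -> : z = u * t ^+ (wt g - wt f).
    apply: (mulIf (expf_neq0 (wt f) t0)).
    by rewrite zE -[RHS]mulrA -exprD subnK.
  apply: place_ringM; first exact: place_unit_ring.
  exact: place_ringX (place_ideal_ring Pt).
apply/negP => Oz; have := place_ideal_nunit (_ : u \in place_ideal P).
rewrite Uu => H; apply/notF/H.
have -> : u = t ^+ (wt f - wt g) * z.
  apply: (mulIf (expf_neq0 (wt g) t0)).
  by rewrite -zE [RHS]mulrAC -exprD subnK 1?mulrC // ltnW.
by rewrite place_idealM // place_idealX // subn_gt0.
Qed.

End OtherPlaces.

Lemma place_ring_ev (P : place F) f : P <> inf_place -> ev f \in place_ring P.
Proof.
move=> nP; have Ox : xeval F 'X \in place_ring P.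
  by apply/negPn/negP => /place_of_pole_X.
have Oc c : xeval F c \in place_ring P.
  rewrite (xeval_sum (leqnn _)) place_ring_sum // => i _.
  by rewrite place_ringM ?place_ring_const ?place_ringX.
rewrite /ev_at (eval2_sum _ _ (leqnn _)) place_ring_sum // => j _.
by rewrite place_ringM ?place_ringX ?place_ring_Y //; apply: Oc.
Qed.

End InfinitePlace.

(** * Translations of Y and the norm *)

(** When L(Y + ga) = L(Y), an automorphism of K[x, y] over K[x]. *)
Definition shift (ga : K) : R2 -> R2 := comp_poly ('X + ga%:P%:P).
HB.instance Definition _ ga := GRing.RMorphism.on (shift ga).

Lemma size_shift ga f : size (shift ga f) = size f.
Proof. by rewrite /shift /= size_comp_poly2 // size_XaddC. Qed.

Lemma shift_comp ga de f : shift de (shift ga f) = shift (ga + de) f.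
Proof.
rewrite /shift /= -comp_polyA comp_polyD comp_polyX comp_polyC -addrA -!polyCD.
by rewrite [de + _]addrC.
Qed.

Lemma shift_neq0 ga f : f != 0 -> shift ga f != 0.
Proof. by rewrite -!size_poly_gt0 size_shift. Qed.

(** Replacing Y by Y + ga only adds monomials of lower weight. *)
Lemma filtered_shift ga f W : filtered f W -> filtered (shift ga f) W.
Proof.
move=> fW; rewrite /shift /= comp_polyE; elim/big_ind: _ => //.
- by move=> i j _; rewrite !coef0.
- by move=> f1 f2; apply: filteredD.
move=> k _; have [-> | fk] := eqVneq f`_k 0.
  by move=> i j _; rewrite scale0r !coef0.
have leW : (m * k <= W)%N.
  rewrite leqNgt; apply: contra fk => lt; apply/eqP/polyP => i.
  by rewrite coef0 fW // (leq_trans lt) ?leq_addl.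
rewrite -mul_polyC -(subnK leW); apply: filteredM.
  move=> i [|j] lt; rewrite coefC /= ?coef0 //.
  by rewrite fW //; move: lt; rewrite muln0 addn0 ltn_subLR // addnC.
elim: (k : nat) => [|k' IH].
  move=> i [|j] lt; rewrite expr0 -polyC1 coefC /= ?coef0 //.
  by rewrite -polyC1 coefC; case: i lt => //; rewrite !muln0.
rewrite exprS mulnS; apply: filteredM => // i j lt.
rewrite coefD coefX !coefC; case: j lt => [|[|j]] /= lt; rewrite ?addr0 ?coef0 //.
  by rewrite add0r coefC; case: i lt => //; rewrite !muln0.
rewrite coefC; case: i lt => //; by rewrite muln0 muln1 ltnn.
Qed.

Lemma shift_curve ga : L \Po ('X + ga%:P) = L -> shift ga G = G.
Proof.
move=> LE; rewrite /shift /= /curve_poly comp_polyB comp_polyC; congr (_ - _).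
rewrite -[in RHS]LE map_comp_poly /= rmorphD /= map_polyX map_polyC /=.
by [].
Qed.

Lemma point_eval_shift (K' : fieldType) (iota : {rmorphism K -> K'}) al be ga f :
  point_eval iota al be (shift ga f) = point_eval iota al (be + iota ga) f.
Proof.
rewrite /point_eval /eval2 /horner_morph /shift /= map_comp_poly horner_comp rmorphD /=.
rewrite map_polyX map_polyC hornerD hornerX hornerC.
by congr (_.[_ + _]); apply: horner_morphC.
Qed.

Lemma red_prod (s : seq R2) W :
  (forall f, f \in s -> [/\ (size f <= l)%N, f != 0 & (wt f <= W)%N]) ->
  red (\prod_(f <- s) f) != 0 /\ (wt (red (\prod_(f <- s) f)) <= size s * W)%N.
Proof.
elim: s => [|f s IH] sP.
  rewrite big_nil red_id ?size_poly1 ?(ltnW l_gt1) // oner_neq0; split=> //.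
  by rewrite -polyC1 wtC // size_poly1 muln0.
have [sf f0 wf] := sP f (mem_head _ _).
have [|nz le] := IH; first by move=> g gs; apply: sP; rewrite inE gs orbT.
have srd := size_red (\prod_(g <- s) g).
have [nz' wE] := wt_redM sf srd f0 nz.
have E : red (\prod_(g <- f :: s) g) = red (f * red (\prod_(g <- s) g)).
  rewrite big_cons; set p := \prod_(g <- s) g.
  have pE := red_eq p.
  have fpE := red_eq (f * red p).
  apply: (@red_unique _
            (f * (p %/ G) + (f * red p) %/ G)); first exact: size_red.
  by rewrite mulrDl -addrA -fpE -mulrA -mulrDr -pE.
by rewrite E; split=> //; rewrite wE mulSn leq_add.
Qed.

(** Ga is the group of the l roots of L when L is additive: F is then a Galois extension of
    K(x), with the translations of y by Ga as its automorphisms. *)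
Variables (Ga : seq K) (uGa : uniq Ga) (szGa : size Ga = l).
Hypothesis (GaL : forall ga, ga \in Ga -> L \Po ('X + ga%:P) = L).
Hypothesis (GaD : forall ga de, ga \in Ga -> de \in Ga -> ga + de \in Ga).

Definition norm f : R2 := \prod_(ga <- Ga) shift ga f.

Lemma norm_shift de f : de \in Ga -> shift de (norm f) = norm f.
Proof.
move=> Gde; rewrite /norm [LHS]rmorph_prod /=.
under eq_bigr => ga _ do rewrite shift_comp.
rewrite -(big_map (fun ga => ga + de) xpredT (fun ga => shift ga f)).
apply: perm_big; apply: uniq_perm => //; first by rewrite map_inj_uniq //; apply: addIr.
have sub : {subset [seq ga + de | ga <- Ga] <= Ga}.
  by move=> _ /mapP[ga Gga ->]; apply: GaD.
have [] := uniq_min_size _ sub; rewrite ?size_map //.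
by rewrite map_inj_uniq //; apply: addIr.
Qed.

(** The norm to K(x) of a reduced f is invariant under the shifts, hence, once
    reduced, constant in Y; its weight l deg c is at most l times that of f. *)
Lemma norm_in_Kx f : (size f <= l)%N -> f != 0 ->
  exists2 c, red (norm f) = c%:P & c != 0 /\ ((size c).-1 <= wt f)%N.
Proof.
move=> sf f0; have l0 := ltnW l_gt1.
have [nz le] : red (norm f) != 0 /\ (wt (red (norm f)) <= l * wt f)%N.
  have [|nz le] := @red_prod [seq shift ga f | ga <- Ga] (wt f).
    move=> _ /mapP[ga _ ->]; rewrite size_shift shift_neq0 //; split=> //.
    apply: wt_le => //; apply: filtered_shift; exact: filtered_wt.
  by move: nz le; rewrite big_map size_map szGa.
have shE de : de \in Ga -> shift de (red (norm f)) = red (norm f).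
  move=> Gde; apply/esym.
  apply: (@red_unique _ (shift de (norm f %/ G))).
    by rewrite size_shift size_red.
  rewrite -{1}(norm_shift f Gde) {1}(red_eq (norm f)).
  by rewrite rmorphD rmorphM /= shift_curve // GaL.
set h := red (norm f) in nz le shE *.
have hE : h = (h.[0])%:P.
  apply/eqP; rewrite -subr_eq0; apply/eqP.
  apply: (@roots_geq_poly_eq0 _ _ [seq ga%:P | ga <- Ga]).
  - apply/allP => _ /mapP[ga Gga ->]; apply/rootP; rewrite hornerD hornerN hornerC.
    have /(congr1 (fun g => g.[0])) := shE _ Gga.
    by rewrite /shift /= horner_comp hornerD hornerX hornerC add0r => ->; rewrite subrr.
  - by rewrite map_inj_uniq //; apply: polyC_inj.
  - rewrite size_map szGa (leq_trans (size_polyD _ _)) // geq_max size_red //.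
    by rewrite size_polyN (leq_trans (size_polyC_leq1 _)).
exists h.[0] => //; split; first by apply: contraNneq nz => c0; rewrite hE c0.
by move: le; rewrite hE wtC // leq_mul2l eqn0Ngt l0 -hE.
Qed.

(** * Places at the affine points *)

Lemma point_eval_curve (K' : fieldType) (iota : {rmorphism K -> K'}) al be :
  point_eval iota al be G = (map_poly iota L).[be] - iota w * al ^+ m.
Proof.
rewrite /curve_poly point_evalB point_evalC; congr (_ - _).
  rewrite [LHS]eval2_map_polyC; congr _.[_]; apply: eq_map_poly => c /=.
  by rewrite [LHS]horner_morphC.
by rewrite base_evalE map_polyZ hornerZ map_polyXn hornerXn.
Qed.

(** The place at a point (al, be) of the curve over a finite extension iota of
    K.  A function of K[x, y] is a unit there unless its value is 0, and
    t = pi(x), with pi the minimal polynomial of al, is a uniformizer, since the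
    curve has l distinct points over al. *)
Section AffinePlace.
Variables (K' : finFieldType) (iota : {rmorphism K -> K'}) (al be : K').
Hypothesis onC : (map_poly iota L).[be] = iota w * al ^+ m.
Local Notation evx := (base_eval iota al).
Local Notation phi := (point_eval iota al be).
Variables (pi : {poly K}) (pi0 : pi != 0).
Hypothesis piP : forall c, evx c = 0 <-> pi %| c.

Lemma point_eval_red f : phi (red f) = phi f.
Proof.
rewrite [in RHS](red_eq f) point_evalD point_evalM.
by rewrite point_eval_curve onC subrr mulr0 add0r.
Qed.

Lemma point_eval_eq0 f : ev f = 0 -> phi f = 0.
Proof.
rewrite -ev_red => /eqP.
rewrite ev_eq0 ?size_red // => /eqP f0.
by rewrite -point_eval_red f0 point_eval0.
Qed.

Lemma point_eval_ext f g : ev f = ev g -> phi f = phi g.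
Proof.
move=> E; have /point_eval_eq0 : ev (f - g) = 0 by rewrite evB E subrr.
by rewrite point_evalB => /eqP; rewrite subr_eq0 => /eqP.
Qed.

Lemma ev_neq0_value f : phi f != 0 -> ev f != 0.
Proof. by apply: contraNneq => /point_eval_eq0->. Qed.

Local Notation t := (xeval F pi).
Lemma t_neq0 : t != 0. Proof. by rewrite xeval_eq0. Qed.
Lemma t_ev : t = ev pi%:P. Proof. by rewrite evC. Qed.
Lemma evx_pi : evx pi = 0. Proof. by apply/piP. Qed.

(** The fibre of the curve over al consists of the points (al, be + ga); a
    reduced polynomial vanishing at all of them has too many roots in Y. *)
Lemma fibre_ideal f :
  (forall ga, ga \in Ga -> point_eval iota al (be + iota ga) f = 0) ->
  exists b, ev f = t * ev b.
Proof.
move=> f0; pose g := red f.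
have g0 : map_poly evx g = 0.
  apply: (@roots_geq_poly_eq0 _ _ [seq be + iota ga | ga <- Ga]).
  - apply/allP => _ /mapP[ga Gga ->]; apply/rootP.
    have := f0 _ Gga; rewrite (red_eq f) point_evalD point_evalM.
    by rewrite point_eval_curve (horner_shift _ _ (GaL Gga)) onC subrr mulr0 add0r.
  - by rewrite map_inj_uniq // => a b /addrI /fmorph_inj.
  - rewrite size_map szGa (leq_trans (size_poly _ _)) //.
    exact: size_red.
exists (map_poly (fun c => c %/ pi) g).
rewrite -ev_red -/g t_ev -evM; congr (ev _).
apply/polyP => j; rewrite coefCM coef_map_id0 ?div0p //.
rewrite mulrC divpK //; apply/piP.
by have := congr1 (fun h : {poly K'} => h`_j) g0; rewrite coef_map coef0.
Qed.

(** Values lie in the finite field K', of cardinal Q, so a - a ^ Q vanishes on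
    the whole fibre, while the cofactor 1 - a ^ (Q - 1) is 1 wherever a is 0. *)
Lemma local_principal a : phi a = 0 ->
  exists s b, phi s != 0 /\ ev s * ev a = t * ev b.
Proof.
move=> a0; have Q_gt1 := finNzRing_gt1 K'.
have [ga|b bE] := @fibre_ideal (a - a ^+ #|K'|).
  by rewrite point_evalB point_evalXn expf_card subrr.
exists (1 - a ^+ #|K'|.-1), b; split.
  rewrite point_evalB point_eval1 point_evalXn a0 expr0n.
  by case: #|K'| Q_gt1 => [|[|k]] //= _; rewrite subr0 oner_eq0.
rewrite -bE -evM mulrBl mul1r -exprSr prednK //.
exact: ltnW.
Qed.

(** If c(x) is t ^ n times a regular function near the point, its value there is 0 as long
    as n > 0, so that one factor pi can be removed from c. *)
Lemma ev_order_dvd n (c : {poly K}) s b : phi s != 0 ->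
  ev s * xeval F c = t ^+ n * ev b -> pi ^+ n %| c.
Proof.
elim: n c => [|n IHn] c s0 E; first by rewrite expr0 dvd1p.
have evxc : evx c = 0.
  apply/eqP; have : phi s * evx c = 0.
    rewrite -(point_evalC iota al be) -point_evalM.
    rewrite (@point_eval_ext _ (pi%:P ^+ n.+1 * b)).
      by rewrite point_evalM point_evalXn point_evalC evx_pi exprS !mul0r.
    by rewrite !evM evX !evC E.
  by move/eqP; rewrite mulf_eq0 (negPf s0).
have [d cE] : exists d, c = d * pi by apply/dvdpP/piP.
rewrite cE exprSr dvdp_mul2r // IHn //.
apply: (mulfI t_neq0); rewrite [RHS]mulrA -exprS -E cE xevalM.
by rewrite mulrCA [xeval F d * _]mulrC.
Qed.

(** Either a unit times a is t ^ k times a unit, or it can be divided by t once more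
    ([local_principal]); this stops because a divides a nonzero polynomial in x. *)
Lemma ev_order a : ev a != 0 -> exists n s b,
  [/\ phi s != 0, phi b != 0 & ev s * ev a = t ^+ n * ev b].
Proof.
move=> a0.
have [c c0 [h _ hE]] := ev_frac (ev a)^-1.
have cE : xeval F c = ev h * ev a by rewrite -hE divfK.
suff H k : (exists n s b, [/\ phi s != 0, phi b != 0 & ev s * ev a = t ^+ n * ev b])
   \/ exists s b, phi s != 0 /\ ev s * ev a = t ^+ k * ev b.
  have [//|[s [b [s0 E]]]] := H (size c).
  have /dvdp_leq : pi ^+ size c %| c.
    apply: (@ev_order_dvd _ c s (b * h)) => //.
    by rewrite cE mulrCA E evM mulrCA [ev b * _]mulrC.
  move/(_ c0); rewrite leqNgt; case/negP.
  have pX0 : pi ^+ size c != 0 by rewrite expf_neq0.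
  have szpi := size_point_min_poly pi0 piP.
  by rewrite (polySpred pX0) size_exp ltnS leq_pmull // -ltnS prednK // ltnW.
elim: k => [|k [IH|[s [b [s0 E]]]]]; [right | by left |].
  by exists 1, a; rewrite point_eval1 ev1 oner_eq0 expr0 !mul1r.
have [b0|b0] := eqVneq (phi b) 0; last by left; exists k, s, b.
have [s' [b' [s'0 E']]] := local_principal b0.
right; exists (s' * s), b'; rewrite point_evalM evM mulf_neq0 //; split=> //.
by rewrite -mulrA E mulrCA E' mulrA -exprSr.
Qed.

(** The order n of z at the point, as a relation. *)
Definition affine_ord (z : F) (n : int) : Prop := exists f g,
  [/\ phi f != 0, phi g != 0 & z = t ^ n * (ev f / ev g)].

Lemma affine_ord_uniq z n n' : affine_ord z n -> affine_ord z n' -> n = n'.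
Proof.
wlog le : n n' / n <= n'.
  by move=> H zn zn'; case/orP: (le_total n n') => le; [|symmetry]; apply: H.
case=> f [g [f0 g0 ->]] [f' [g' [f'0 g'0]]] E.
have [k nE] : exists k : nat, n' = n + k%:Z.
  by exists `|n' - n|%N; rewrite gez0_abs ?subr_ge0 // subrKC.
rewrite nE; case: k nE => [|k] nE; first by rewrite addr0.
have tn0 : t ^ n != 0 by rewrite expfz_neq0 // t_neq0.
have : ev (f * g') = ev (pi%:P ^+ k.+1 * (f' * g)).
  move: E; rewrite nE expfzDr ?t_neq0 // -mulrA => /(mulfI tn0).
  rewrite mulrA => /eqP; rewrite eqr_div ?ev_neq0_value // => /eqP.
  by rewrite !evM evX evC -!mulrA => ->.
move/point_eval_ext; rewrite !point_evalM point_evalXn point_evalC evx_pi exprS !mul0r.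
move/eqP.
by rewrite mulf_eq0 (negPf f0) (negPf g'0).
Qed.

Lemma affine_ordM z z' n n' :
  affine_ord z n -> affine_ord z' n' -> affine_ord (z * z') (n + n').
Proof.
case=> f [g [f0 g0 ->]] [f' [g' [f'0 g'0 ->]]].
exists (f * f'), (g * g'); rewrite !point_evalM !evM !mulf_neq0 //; split=> //.
by rewrite mulrACA expfzDr ?t_neq0 // mulf_div.
Qed.

Lemma affine_ordV z n : affine_ord z n -> affine_ord z^-1 (- n).
Proof.
case=> f [g [f0 g0 ->]]; exists g, f; split=> //.
by rewrite invfM invf_div -invr_expz.
Qed.

Lemma affine_ord_ev a : ev a != 0 -> exists n : nat, affine_ord (ev a) n.
Proof.
move=> /ev_order[n [s [b [s0 b0 E]]]]; exists n, b, s; split=> //.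
by rewrite mulrA -exprnP -E mulrC mulKf // ev_neq0_value.
Qed.

Lemma affine_ord_total z : z != 0 -> exists n, affine_ord z n.
Proof.
move=> z0; have [c c0 [a _ aE]] := ev_frac z.
have c0' : xeval F c != 0 by rewrite xeval_eq0.
have [n zn] : exists n : nat, affine_ord (ev a) n.
  by apply: affine_ord_ev; rewrite -aE mulf_neq0.
have [k ck] : exists n : nat, affine_ord (ev c%:P) n.
  by apply: affine_ord_ev; rewrite evC.
exists (- k%:Z + n); rewrite -(mulKf c0' z) aE -evC.
exact: affine_ordM (affine_ordV ck) zn.
Qed.

Definition affine_val (z : F) : int := xget 0 [set n | affine_ord z n]%classic.

Lemma affine_valE z n : affine_ord z n -> affine_val z = n.
Proof.
move=> zn; rewrite /affine_val; case: xgetP => [k _ zk|/(_ n) //].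
exact: affine_ord_uniq zk zn.
Qed.

Lemma affine_val_ord z : z != 0 -> affine_ord z (affine_val z).
Proof. by move=> /affine_ord_total[n zn]; rewrite (affine_valE zn). Qed.

Lemma affine_valP : discrete_valuation affine_val t.
Proof.
split.
- exact: t_neq0.
- apply: affine_valE; exists 1, 1; rewrite !(point_eval1, ev1) oner_eq0; split=> //.
  by rewrite divr1 mulr1 expr1z.
- move=> c c0; apply: affine_valE; exists c%:P%:P, 1.
  rewrite point_eval_const fmorph_eq0 !(point_eval1, ev1) oner_eq0; split=> //.
  by rewrite expr0z mul1r divr1 ev_const.
- move=> z z' z0 z'0; apply: affine_valE.
  exact: affine_ordM (affine_val_ord z0) (affine_val_ord z'0).
move=> k z z' z0 z'0 zz'0.
have [f [g [f0 g0]]] := affine_val_ord z0.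
have [f' [g' [f'0 g'0]]] := affine_val_ord z'0.
set n := affine_val z; set n' := affine_val z' => z'E zE kn kn'.
have [i nE] : exists i : nat, n = k + i%:Z.
  by exists `|n - k|%N; rewrite gez0_abs ?subr_ge0 // subrKC.
have [i' n'E] : exists i : nat, n' = k + i%:Z.
  by exists `|n' - k|%N; rewrite gez0_abs ?subr_ge0 // subrKC.
pose h := pi%:P ^+ i * f * g' + pi%:P ^+ i' * f' * g.
have E : z + z' = t ^ k * (ev h / ev (g * g')).
  rewrite zE z'E nE n'E !expfzDr ?t_neq0 // -!exprnP -!mulrA -mulrDr.
  congr (_ * _); rewrite evD !evM !evX evC.
  by rewrite !mulrA addf_div ?ev_neq0_value.
have h0 : ev h != 0.
  by apply: contraNneq zz'0 => h0; rewrite E h0 mul0r mulr0.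
have [j [a [b [a0 b0 hE]]]] := affine_ord_ev h0.
have -> : affine_val (z + z') = k + j%:Z.
  apply: affine_valE; exists a, (b * (g * g')).
  rewrite !point_evalM !mulf_neq0 //; split=> //.
  by rewrite E hE expfzDr ?t_neq0 // !evM !invfM !mulrA.
by rewrite lerDl.
Qed.

Definition affine_place : place F := dval_place affine_valP.

Lemma affine_place_ev a : ev a \in place_ring affine_place.
Proof.
have [->|a0] := eqVneq (ev a) 0; first exact: place_ring0.
have [n an] := affine_ord_ev a0.
by rewrite dval_place_ring // (affine_valE an).
Qed.

Lemma affine_place_unit a : phi a != 0 -> ev a \in place_unit affine_place.
Proof.
move=> a0; rewrite dval_place_unit ?ev_neq0_value //; apply/eqP/affine_valE.
exists a, 1; rewrite point_eval1 ev1 oner_eq0; split=> //.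
by rewrite expr0z mul1r divr1.
Qed.

Lemma affine_place_ideal a : phi a = 0 -> ev a \in place_ideal affine_place.
Proof.
move=> a0; have [->|ea0] := eqVneq (ev a) 0; first exact: place_ideal0.
have [n [s [b [s0 b0 E]]]] := ev_order ea0.
have an : affine_ord (ev a) n.
  exists b, s; split=> //; by rewrite mulrA -exprnP -E mulrC mulKf // ev_neq0_value.
rewrite dval_place_ideal // (affine_valE an) ltz_nat.
case: n E {an} => // E; have : phi s * phi a = phi b.
  by rewrite -point_evalM; apply: point_eval_ext; rewrite evM E expr0 mul1r.
by rewrite a0 mulr0 => bE; rewrite -bE eqxx in b0.
Qed.

Lemma affine_place_frac z : z \in place_ring affine_place ->
  exists f g, phi g != 0 /\ z = ev f / ev g.
Proof.
have [->|z0] := eqVneq z 0.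
  by exists 0, 1; rewrite ev0 mul0r point_eval1 oner_eq0.
rewrite dval_place_ring // => vz.
have [f [g [f0 g0 zE]]] := affine_val_ord z0.
case: (affine_val z) vz zE => // n _ zE.
by exists (pi%:P ^+ n * f), g; rewrite evM evX evC zE mulrA.
Qed.

End AffinePlace.
End Curve.

(** * Functions with poles only at infinity *)

Section CurveCode.
Variables (K : finFieldType) (l r : nat) (L : {poly K}) (w mu : K).
Hypotheses (l_gt1 : (1 < l)%N) (monL : L \is monic) (szL : size L = l.+1).
Hypotheses (mu0 : mu != 0) (muw : mu ^+ l = w).
Local Notation m := (r * l).+1.
Local Notation R2 := {poly {poly K}}.
Local Notation G := (curve_poly l r L w).
Local Notation Kx := {fraction {poly K}}.
Local Notation red := (red l r L w).
Local Notation wt := (wt l r mu).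
Variables (F : fieldExtType Kx) (y : F) (Fy : curve_field l r L w y).
Local Notation ev := (ev_at y).
Variables (Ga : seq K) (uGa : uniq Ga) (szGa : size Ga = l).
Hypothesis (GaL : forall ga, ga \in Ga -> L \Po ('X + ga%:P) = L).
Implicit Types f g a b s : R2.

Local Notation Pinf := (inf_place l_gt1 monL szL mu0 muw Fy).

(** Let al be a root of the denominator c of z = a / c.  If a(al, Y) = 0, the
    fraction can be simplified by the minimal polynomial of al.  Otherwise
    a(al, Y) has degree < l and does not vanish at all the l points of the curve
    over al; z has a pole at one of them. *)
Lemma pole_of_denominator (c : {poly K}) a (z : F) :
  (size a <= l)%N -> (1 < size c)%N -> xeval F c * z = ev a ->
  (exists P : place F, P <> Pinf /\ valuation P z < 0) \/
  exists (d : {poly K}) b,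
    [/\ (size b <= l)%N, d != 0, (size d < size c)%N & xeval F d * z = ev b].
Proof.
move=> sa c_gt1 czE.
have c0 : c != 0 by rewrite -size_poly_gt0 ltnW.
have [K1 [io1 [al1 ral1]]] := finite_root_extension c_gt1.
pose D := map_poly io1 L - (io1 w * al1 ^+ m)%:P.
have szD : (1 < size D)%N.
  have szL1 : size (map_poly io1 L) = l.+1 by rewrite size_map_poly.
  rewrite size_polyDl szL1 ?ltnS; first exact: ltnW.
  by rewrite size_polyN (leq_trans (size_polyC_leq1 _)) // ltnW.
have [K2 [io2 [be /rootP rbe]]] := finite_root_extension szD.
pose io : {rmorphism K -> K2} := io2 \o io1.
pose al := io2 al1.
have onC ga : ga \in Ga -> (map_poly io L).[be + io ga] = io w * al ^+ m.
  move=> Gga; rewrite (horner_shift _ _ (GaL Gga)); apply/eqP; rewrite -subr_eq0.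
  move: rbe; rewrite /D rmorphB /= map_polyC /= -map_poly_comp.
  by rewrite hornerD hornerN hornerC rmorphM rmorphXn => ->.
have evc : base_eval io al c = 0.
  by rewrite base_evalE map_poly_comp horner_map (rootP ral1) rmorph0.
have [pi pi0 piP] := point_min_poly io al.
have [a0|a0] := eqVneq (map_poly (base_eval io al) a) 0.
  right; exists (c %/ pi), (map_poly (fun e => e %/ pi) a).
  have cE : c = c %/ pi * pi by rewrite divpK //; apply/piP.
  have pi_gt1 := size_point_min_poly pi0 piP.
  have d0 : c %/ pi != 0 by apply: contraNneq c0 => d0; rewrite cE d0 mul0r.
  split=> //.
  - exact: leq_trans (size_poly _ _) sa.
  - by rewrite size_divp // ltn_subrL -ltnS prednK ?(ltnW pi_gt1) // pi_gt1 size_poly_gt0.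
  have aE : a = pi%:P * map_poly (fun e => e %/ pi) a.
    apply/polyP => j; rewrite coefCM coef_map_id0 ?div0p // mulrC divpK //.
    apply/piP; have := congr1 (fun h : {poly K2} => h`_j) a0.
    by rewrite coef_map coef0.
  have t0 : xeval F pi != 0 by rewrite xeval_eq0.
  apply: (mulfI t0); rewrite mulrA -xevalM mulrC [pi * _]mulrC -cE mulrC czE.
  by rewrite [in LHS]aE evM evC.
left.
have [ga Gga phia] : exists2 ga, ga \in Ga & point_eval io al (be + io ga) a != 0.
  apply/hasP; apply: contraNT a0 => /hasPn none; apply/eqP.
  apply: (@roots_geq_poly_eq0 _ _ [seq be + io ga | ga <- Ga]).
  - by apply/allP => _ /mapP[ga Gga ->]; have := none _ Gga; rewrite negbK.
  - by rewrite map_inj_uniq // => e e' /addrI /fmorph_inj.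
  - by rewrite size_map szGa (leq_trans (size_poly _ _)).
pose P := affine_place l_gt1 monL szL Fy uGa szGa GaL (onC ga Gga) pi0 piP.
have Ua : ev a \in place_unit P by apply: affine_place_unit.
have Ic : ev c%:P \in place_ideal P.
  by apply: affine_place_ideal; rewrite point_evalC.
have kc0 : xeval F c != 0 by rewrite xeval_eq0.
have z0 : z != 0.
  apply: contraTneq Ua => z0; rewrite -czE z0 mulr0.
  by apply/negP => /place_unit_neq0; rewrite eqxx.
exists P; split.
  move=> PE; have := inf_place_X l_gt1 monL szL mu0 muw Fy.
  rewrite -PE -(evC y) => /negP; apply; exact: affine_place_ev.
have Pz : z^-1 \in place_ideal P.
  have -> : z^-1 = ev c%:P * (ev a)^-1.
    by rewrite -czE evC invfM mulrA divff // mul1r.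
  by rewrite place_idealM // place_unit_ring // place_unitV.
have vP := affine_valP l_gt1 monL szL Fy uGa szGa GaL (onC ga Gga) pi0 piP.
rewrite dval_place_valuation //; move: Pz; rewrite dval_place_ideal ?invr_eq0 //.
by rewrite (dvalV vP) // oppr_gt0.
Qed.

(** Functions whose only pole is the place at infinity are polynomials in x
    and y: a denominator of least degree is constant. *)
Lemma regular_ev (z : F) :
  (forall P : place F, P <> Pinf -> 0 <= valuation P z) ->
  exists2 a : R2, (size a <= l)%N & z = ev a.
Proof.
move=> reg.
pose Q n := `[<exists (c : {poly K}) (a : R2),
  [/\ (size a <= l)%N, c != 0, size c = n & xeval F c * z = ev a]>].
have exQ : exists n, Q n.
  have [c c0 [a sa aE]] := ev_frac l_gt1 monL szL Fy z.
  by exists (size c); apply/asboolP; exists c, a.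
case: (ex_minnP exQ) => n /asboolP[c [a [sa c0 szc czE]]] minn.
have [c_le1|c_gt1] := leqP (size c) 1.
  have cE := size1_polyC c_le1.
  have k0 : c`_0 != 0 by apply: contraNneq c0 => k0; rewrite cE k0.
  exists ((c`_0)^-1%:P%:P * a).
    by rewrite mul_polyC (leq_trans (size_scale_leq _ _)).
  rewrite evM ev_const -czE cE xevalC coefC /= mulrA -rmorphM mulVf //.
  by rewrite rmorph1 mul1r.
case: (pole_of_denominator sa c_gt1 czE) => [[P [nP]]|[d [b [sb d0 ltd E]]]].
  by rewrite ltNge reg.
have : Q (size d) by apply/asboolP; exists d, b.
by move/minn; rewrite leqNgt -szc ltd.
Qed.

Definition inf_divisor_coef (W : nat) (P : place F) : int :=
  if `[<P = Pinf>] then W%:Z else 0.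

Lemma inf_divisor_finite W :
  finite_set [set P : place F | inf_divisor_coef W P != 0]%classic.
Proof.
apply: (@sub_finite_set _ _ [set Pinf]%classic); last exact: finite_set1.
by move=> P; rewrite /= /inf_divisor_coef; case: asboolP => // _; rewrite eqxx.
Qed.

Definition inf_divisor W : divisor F := Divisor (@inf_divisor_finite W).

Lemma inf_divisor_other W P : P <> Pinf -> inf_divisor W P = 0.
Proof. by rewrite /= /inf_divisor_coef; case: asboolP. Qed.

(** [regular_ev] gives one inclusion and [place_ring_ev] the other; the coefficient at
    infinity bounds the weight. *)
Lemma riemann_roch_inf W (z : F) :
  riemann_roch_space (inf_divisor W) z <->
  exists f : R2, [/\ (size f <= l)%N, (wt f <= W)%N & z = ev f].
Proof.
split.
  case=> [->|Gz].
    exists 0; rewrite size_poly0 ev0; split=> //.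
    by rewrite -polyC0 wtC // size_poly0 muln0.
  have [|f sf zE] := @regular_ev z.
    by move=> P nP; have := Gz P; rewrite inf_divisor_other // addr0.
  exists f; split=> //.
  have [->|f0] := eqVneq f 0; first by rewrite -polyC0 wtC // size_poly0 muln0.
  have := Gz Pinf; rewrite zE inf_place_valuation //= /inf_divisor_coef.
  by rewrite asboolT // addrC subr_ge0 lez_nat.
case=> f [sf wf ->]; have [->|f0] := eqVneq f 0; first by left; rewrite ev0.
right=> P; have [->|nP] := pselect (P = Pinf).
  rewrite inf_place_valuation //= /inf_divisor_coef asboolT //.
  by rewrite addrC subr_ge0 lez_nat.
rewrite inf_divisor_other // addr0; apply: valuation_ge0.
exact: place_ring_ev nP.
Qed.

(** * Rational points and number of zeros *)

Hypothesis (GaD : forall ga de, ga \in Ga -> de \in Ga -> ga + de \in Ga).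
Implicit Types p : K * K.

Definition curve_points : {set K * K} :=
  [set p | L.[p.2] == w * p.1 ^+ m]%SET.
Local Notation S := curve_points.

Definition value p f : K := point_eval (idfun : {rmorphism K -> K}) p.1 p.2 f.

Lemma map_idfun_poly (c : {poly K}) : map_poly (idfun : {rmorphism K -> K}) c = c.
Proof. exact: map_poly_id. Qed.

Lemma curve_pointsP p : p \in S ->
  (map_poly (idfun : {rmorphism K -> K}) L).[p.2] = idfun w * p.1 ^+ m.
Proof. by rewrite inE map_idfun_poly => /eqP. Qed.

Lemma XsubC_prime (al : K) c :
  base_eval (idfun : {rmorphism K -> K}) al c = 0 <-> 'X - al%:P %| c.
Proof. by rewrite base_evalE map_idfun_poly dvdp_XsubCl; split=> /rootP. Qed.

Lemma XsubC_neq0 (al : K) : 'X - al%:P != 0.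
Proof. by rewrite polyXsubC_eq0. Qed.

Definition point_place p (pS : p \in S) : place F :=
  affine_place l_gt1 monL szL Fy uGa szGa GaL (curve_pointsP pS)
    (XsubC_neq0 p.1) (@XsubC_prime p.1).

Section OnePoint.
Variables (p : K * K) (pS : p \in S).
Local Notation P := (point_place pS).

Lemma point_place_ev f : ev f - kconst F (value p f) \in place_ideal P.
Proof.
rewrite -(ev_const y) -evB; apply: affine_place_ideal.
by rewrite point_evalB point_eval_const subrr.
Qed.

Lemma point_residue_uniq z c d :
  z - kconst F c \in place_ideal P -> z - kconst F d \in place_ideal P -> c = d.
Proof.
move=> Pc Pd; have := place_idealB Pd Pc; rewrite opprB addrC subrKA.
rewrite -rmorphB => /place_ideal_const /eqP.
by rewrite subr_eq0 => /eqP.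
Qed.

Lemma point_place_eval f : place_eval P (ev f) = value p f.
Proof.
rewrite /place_eval; case: xgetP => [c _ Pc|/(_ (value p f)) []].
  exact: point_residue_uniq Pc (point_place_ev f).
exact: point_place_ev.
Qed.

(** A function regular at the point is f / g with g nonzero there, so its residue is the
    constant f(p) / g(p). *)
Lemma point_place_rational : rational_place P.
Proof.
exists (fun=> 1); split=> [i|z Oz]; first exact: place_ring1.
have [f [g [g0 zE]]] := affine_place_frac Oz.
pose c := value p f / value p g.
have Pc : z - kconst F c \in place_ideal P.
  have eg0 : ev g != 0.
    by apply: contraNneq g0 => /(point_eval_eq0 l_gt1 monL szL Fy (curve_pointsP pS)) ->.
  have -> : z - kconst F c = ev (f - c%:P%:P * g) * (ev g)^-1.
    by rewrite evB evM ev_const zE mulrBl mulfK.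
  rewrite place_idealM //; last first.
    by rewrite place_unit_ring // place_unitV // affine_place_unit.
  apply: affine_place_ideal.
  by rewrite point_evalB point_evalM point_eval_const /c /= divfK ?subrr.
exists (const_mx c); split=> [|d]; rewrite big_ord1 mulr1 ?mxE //.
move=> Pd; apply/rowP => i; rewrite mxE !ord1.
exact: point_residue_uniq Pc Pd.
Qed.

Lemma point_place_neq_inf : P <> inf_place l_gt1 monL szL mu0 muw Fy.
Proof.
move=> PE; have := inf_place_X l_gt1 monL szL mu0 muw Fy.
rewrite -PE -(evC y) => /negP; apply; exact: affine_place_ev.
Qed.

End OnePoint.

Lemma point_place_inj p p' (pS : p \in S) (pS' : p' \in S) :
  point_place pS = point_place pS' -> p = p'.
Proof.
move=> E; have H f : value p f = value p' f.
  by rewrite -(point_place_eval pS) E point_place_eval.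
move: (H 'X%:P) (H 'X); rewrite /value !point_eval_X !point_eval_Y.
by case: p p' {pS pS' E H} => a b [a' b'] /= -> ->.
Qed.

(** The l translates of be by Ga already exhaust the roots of L(Y) - w al^m. *)
Lemma fibre_shift al be be' : (al, be) \in S -> (al, be') \in S ->
  be' - be \in Ga.
Proof.
rewrite !inE /= => /eqP Sb /eqP Sb'; apply: contraT => nGa.
have : (size (be' :: [seq (be + ga)%R | ga <- Ga]) < size (L - (w * al ^+ m)%:P)%R)%N.
  apply: max_poly_roots.
  - rewrite -size_poly_eq0 size_polyDl ?szL // size_polyN.
    by rewrite ltnS (leq_trans (size_polyC_leq1 _)) // ltnW.
  - rewrite /= rootE hornerD hornerN hornerC Sb' subrr eqxx /=.
    apply/allP => _ /mapP[ga Gga ->]; rewrite rootE hornerD hornerN hornerC.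
    have := horner_shift (idfun : {rmorphism K -> K}) be (GaL Gga).
    by rewrite map_idfun_poly Sb => ->; rewrite subrr.
  rewrite /= map_inj_uniq ?uGa ?andbT; last exact: addrI.
  apply: contra nGa => /mapP[ga Gga ->]; by rewrite addrC addKr.
rewrite /= size_map szGa size_polyDl ?szL ?ltnn // size_polyN.
by rewrite ltnS (leq_trans (size_polyC_leq1 _)) // ltnW.
Qed.

Definition zeros f : {set K * K} := [set p in S | value p f == 0]%SET.

(** A zero of f at (al, be + ga) is a zero of its shift by ga at (al, be), so
    each contributes a factor x - al to the norm of f. *)
Lemma norm_multiplicity f c al : red (norm Ga f) = c%:P ->
  ('X - al%:P) ^+ #|[set be | (al, be) \in zeros f]%SET| %| c.
Proof.
move=> cE; set Z := [set be | _]%SET.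
have [->|[be0]] := set_0Vmem Z; first by rewrite cards0 expr0 dvd1p.
rewrite !inE => /andP[Sbe0 _].
have pS : (al, be0) \in S by rewrite inE.
have onC := curve_pointsP pS; rewrite /= in onC.
pose zs := [seq ga <- Ga |
  point_eval (idfun : {rmorphism K -> K}) al be0 (shift ga f) == 0].
have leZ : (#|Z| <= size zs)%N.
  rewrite cardE -(size_map (fun be => be - be0)); apply: uniq_leq_size.
    by rewrite map_inj_uniq ?enum_uniq //; apply: addIr.
  move=> _ /mapP[be + ->]; rewrite mem_enum inE inE => /andP[Sbe fbe].
  rewrite mem_filter (fibre_shift pS Sbe) andbT point_eval_shift /=.
  by rewrite addrC subrK.
apply: dvdp_trans (dvdp_exp2l _ leZ) _.
have [s [b [s0 E]]] : exists s b,
    point_eval (idfun : {rmorphism K -> K}) al be0 s != 0 /\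
    ev s * ev (norm Ga f) = xeval F ('X - al%:P) ^+ size zs * ev b.
  rewrite /norm /zs; elim: (Ga) => [|ga s [s1 [b1 [s10 E1]]]].
    by exists 1, 1; rewrite big_nil point_eval1 oner_eq0 expr0 ev1 !mul1r.
  rewrite big_cons /= evM; case: ifPn => [/eqP z|nz].
    have [s2 [b2 [s20 E2]]] :=
      local_principal l_gt1 monL szL Fy uGa szGa GaL onC (@XsubC_prime al) z.
    exists (s2 * s1), (b2 * b1); rewrite point_evalM mulf_neq0 //; split=> //.
    by rewrite !evM mulrACA E2 E1 /= exprS mulrACA.
  exists s1, (shift ga f * b1); split=> //.
  by rewrite mulrCA E1 evM mulrCA.
have {}E : ev s * xeval F c = xeval F ('X - al%:P) ^+ size zs * ev b.
  by rewrite -E -(evC y) -cE (ev_red l_gt1 monL szL Fy).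
exact: (ev_order_dvd l_gt1 monL szL Fy onC (XsubC_neq0 al) (@XsubC_prime al) s0 E).
Qed.

(** The multiplicities in [norm_multiplicity] add up to at most the degree of the norm. *)
Lemma card_zeros f : (size f <= l)%N -> f != 0 -> (#|zeros f| <= wt f)%N.
Proof.
move=> sf f0.
have [c cE [c0 szc]] := norm_in_Kx r l_gt1 monL szL mu0 muw uGa szGa GaL GaD sf f0.
apply: leq_trans szc.
have -> : #|zeros f| = (\sum_(al <- enum K) #|[set be | (al, be) \in zeros f]%SET|)%N.
  rewrite big_enum /= -sum1_card.
  transitivity (\sum_(p | (p.1, p.2) \in zeros f) 1)%N.
    by apply: eq_bigl => -[].
  rewrite -(pair_big_dep xpredT (fun al be => (al, be) \in zeros f)
              (fun _ _ => 1%N)) /=.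
  apply: eq_bigr => al _; rewrite -sum1_card; apply: eq_bigl => be.
  by rewrite [in RHS]inE.
have /dvdp_leq : \prod_(al <- enum K)
    ('X - al%:P) ^+ #|[set be | (al, be) \in zeros f]%SET| %| c.
  apply: dvdp_prod_XsubC_exp => [|al _]; first exact: enum_uniq.
  exact: norm_multiplicity.
by rewrite size_prod_XsubC_exp => /(_ c0); case: (size c).
Qed.

(** * The code *)

(** The code of all functions whose weight is at most W, of length N; mons
    lists the exponents of the monomials of weight at most W.  As W < N, a
    nonzero function of the code does not vanish at all the points. *)
Variables (N W : nat) (cardS : #|S| = N) (W_lt_N : (W < N)%N).
Variables (mons : seq (nat * nat)) (umons : uniq mons).
Hypothesis monsP : forall i j,
  ((i, j) \in mons) = (j < l)%N && (l * i + m * j <= W)%N.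

Definition point (i : 'I_N) : K * K := enum_val (cast_ord (esym cardS) i).

Lemma point_curve i : point i \in S. Proof. exact: enum_valP. Qed.

Lemma point_inj : injective point.
Proof. by move=> i j /enum_val_inj /cast_ord_inj. Qed.

Lemma point_surj p : p \in S -> exists i, p = point i.
Proof.
move=> pS; exists (cast_ord cardS (enum_rank_in pS p)).
by rewrite /point cast_ordK enum_rankK_in.
Qed.

Definition word f : 'rV[K]_N := \row_i value (point i) f.

Lemma wordB f g : word (f - g) = word f - word g.
Proof. by apply/rowP => i; rewrite !mxE; apply: point_evalB. Qed.

Lemma word_lin (I : Type) (s : seq I) (c : I -> K) (f : I -> R2) :
  word (\sum_(i <- s) (c i)%:P%:P * f i) = \sum_(i <- s) c i *: word (f i).
Proof.
apply/rowP => k; rewrite mxE summxE [LHS]rmorph_sum; apply: eq_bigr => i _.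
by rewrite !mxE [LHS]point_evalM point_eval_const.
Qed.

Lemma card_word0 f : #|[pred i | word f 0 i == 0]| = #|zeros f|.
Proof.
rewrite -(card_imset _ point_inj); apply: eq_card => p; rewrite [RHS]inE.
apply/imsetP/andP => [[i + ->]|[pS fp]]; first by rewrite inE mxE point_curve.
by have [i pE] := point_surj pS; exists i; rewrite // inE mxE -pE.
Qed.

Lemma word_weight f :
  #|[pred i | word f 0 i != 0]| = (N - #|zeros f|)%N.
Proof.
rewrite -card_word0; set Z := [pred i | word f 0 i == 0].
transitivity (#|Z| + #|[predC Z]| - #|Z|)%N; last by rewrite cardC card_ord.
by rewrite addKn; apply: eq_card => i; rewrite !inE.
Qed.

Definition regular f := (size f <= l)%N && (wt f <= W)%N.

Lemma card_zeros_regular f : regular f -> f != 0 -> (#|zeros f| <= W)%N.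
Proof.
case/andP=> sf wf f0; apply: leq_trans wf.
exact: (card_zeros sf f0).
Qed.

Lemma regularB f g : regular f -> regular g -> regular (f - g).
Proof.
case/andP=> sf wf /andP[sg wg]; apply/andP; split.
  by rewrite (leq_trans (size_polyD _ _)) // geq_max sf size_polyN.
apply: wtD wf _; apply: wt_le => //; apply: filteredN.
exact: filtered_mono wg (filtered_wt l_gt1 mu0 sg).
Qed.

Local Notation n := (size mons).
Local Notation mon t := (tnth (in_tuple mons) t).

Definition monomial (e : nat * nat) : R2 := ('X^(e.1))%:P * 'X^(e.2).

Definition combination (k : 'I_n -> K) : R2 :=
  \sum_t (k t)%:P%:P * monomial (mon t).

Lemma coef_monomial (k : K) e i j :
  (k%:P%:P * monomial e)`_j`_i = if (i, j) == e then k else 0.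
Proof.
case: e => a b; rewrite !coefCM coefXn xpair_eqE /=.
case: (j == b); rewrite ?andbF ?andbT ?mulr0 ?coef0 ?mulr0 //.
by rewrite mulr1 coefXn; case: (i == a); rewrite ?mulr1 ?mulr0.
Qed.

Lemma coef_combination k t : (combination k)`_(mon t).2`_(mon t).1 = k t.
Proof.
rewrite /combination !coef_sum (bigD1 t) //= coef_monomial -surjective_pairing.
rewrite eqxx big1 ?addr0 // => t' nt; rewrite coef_monomial -surjective_pairing.
by rewrite (inj_eq (@tuple_uniqP _ _ (in_tuple mons) umons)) eq_sym (negPf nt).
Qed.

Lemma combination_regular k : regular (combination k).
Proof.
have H i j : (combination k)`_j`_i != 0 -> (i, j) \in mons.
  apply: contraR => nij; rewrite /combination !coef_sum big1 // => t _.
  rewrite coef_monomial; case: eqP => // E; case/negP: nij; rewrite E.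
  exact: mem_tnth.
apply/andP; split.
  apply/leq_sizeP => j lej; apply/polyP => i; rewrite coef0; apply/eqP.
  by apply: contraT => /H; rewrite monsP ltnNge lej.
apply: wt_le => // i j lt; apply/eqP; apply: contraT => /H.
by rewrite monsP [(_ <= W)%N]leqNgt lt andbF.
Qed.

Lemma regular_combination f : regular f ->
  f = combination (fun t => f`_(mon t).2`_(mon t).1).
Proof.
case/andP=> sf wf; apply/polyP => j; apply/polyP => i.
case: (boolP ((i, j) \in mons)) => [|nij].
  case/(tnthP (in_tuple mons)) => t E.
  have := coef_combination (fun t => f`_(mon t).2`_(mon t).1) t.
  by rewrite -E.
rewrite /combination !coef_sum big1 => [|t _]; last first.
  rewrite coef_monomial; case: eqP => // E; case/negP: nij; rewrite E.
  exact: mem_tnth.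
move: nij; rewrite monsP negb_and -leqNgt -ltnNge => /orP[lej|lt].
  have -> : f`_j = 0 by rewrite nth_default // (leq_trans sf).
  by rewrite coef0.
apply: (filtered_wt l_gt1 mu0 sf); exact: leq_ltn_trans lt.
Qed.

Definition code : {vspace 'rV[K]_N} :=
  <<map_tuple (word \o monomial) (in_tuple mons)>>%VS.

Lemma word_combination k : word (combination k) =
  \sum_t k t *: (map_tuple (word \o monomial) (in_tuple mons))`_t.
Proof.
by rewrite word_lin; apply: eq_bigr => t _; rewrite -tnth_nth tnth_map.
Qed.

Lemma mem_code c : c \in code <-> exists2 f, regular f & c = word f.
Proof.
split=> [cC|[f rf ->]].
  exists (combination (fun t =>
    coord (map_tuple (word \o monomial) (in_tuple mons)) t c)).
    exact: combination_regular.
  by rewrite word_combination -coord_span.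
rewrite (regular_combination rf) word_combination memv_suml // => t _.
by rewrite memvZ // memv_span // -tnth_nth mem_tnth.
Qed.

(** A combination of the monomials giving the zero word has N > W zeros. *)
Lemma dim_code : \dim code = n.
Proof.
suff fr : free (map_tuple (word \o monomial) (in_tuple mons)).
  by move: fr; rewrite /free => /eqP->; rewrite size_tuple.
apply/freeP => k; rewrite -word_combination => w0 t.
have [E|nz] := eqVneq (combination k) 0.
  by rewrite -(coef_combination k t) E !coef0.
have := card_zeros_regular (combination_regular k) nz.
rewrite -card_word0 leqNgt => /negP[].
rewrite (eq_card (_ : _ =i predT)) ?card_ord // => i.
by rewrite inE w0 mxE eqxx.
Qed.

Lemma code_is_AG : is_AG_code code.
Proof.
have N_gt0 : (0 < N)%N by apply: leq_ltn_trans W_lt_N.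
exists F, (fun i => point_place (point_curve i)).
exists (inf_divisor W); split.
- apply: (full_constant_field_of_rational
    (point_place_rational (point_curve (Ordinal N_gt0)))).
- by move=> i j /point_place_inj /point_inj.
- by move=> i; apply: point_place_rational.
- by move=> i; apply: inf_divisor_other; apply: point_place_neq_inf.
move=> c; split.
  case/mem_code => f /andP[sf wf] ->; exists (ev f).
    by apply/riemann_roch_inf; exists f.
  by apply/rowP => i; rewrite !mxE point_place_eval.
case=> z /riemann_roch_inf [f [sf wf ->]] <-.
apply/mem_code; exists f; first exact/andP.
by apply/rowP => i; rewrite !mxE point_place_eval.
Qed.

Lemma hamming_word f g :
  hamming_dist (word f) (word g) = (N - #|zeros (f - g)|)%N.
Proof.
rewrite -word_weight; apply: eq_card => i.
by rewrite !inE wordB !mxE subr_eq0.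
Qed.

(** The distance of two words is N minus the number of zeros of a nonzero function of the
    code, which is at most W; the bound is reached by a function with W zeros. *)
Lemma code_min_distance f : regular f -> (W <= #|zeros f|)%N -> f != 0 ->
  min_distance code (N - W).
Proof.
move=> rf Wf f0; split.
  have r0 : regular 0.
    rewrite /regular size_poly0 /=; apply: wt_le => // i j _.
    by rewrite !coef0.
  have Ef : #|zeros f| = W by apply/eqP; rewrite eqn_leq Wf card_zeros_regular.
  have d : hamming_dist (word f) (word 0) = (N - W)%N.
    by rewrite hamming_word subr0 Ef.
  exists (word f), (word 0); split=> //.
  - by apply/mem_code; exists f.
  - by apply/mem_code; exists 0.
  apply: contraTneq W_lt_N => E; move: d; rewrite E.
  have -> : hamming_dist (word 0) (word 0) = 0%N.
    by apply: eq_card0 => i; rewrite !inE eqxx.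
  by move/esym/eqP; rewrite subn_eq0 -leqNgt.
move=> _ _ /mem_code[g rg ->] /mem_code[h rh ->] ne.
rewrite hamming_word leq_sub2l // card_zeros_regular ?regularB //.
by apply: contraNneq ne => /eqP; rewrite subr_eq0 => /eqP->.
Qed.

End CurveCode.

(** * The curve y ^ (q / p) + ... + y ^ p + y = w x ^ (q + 1) *)

Section Frobenius.
Variables (R : comNzRingType) (p : nat) (pR : p \in [pchar R]).

Lemma pchar_pow k : [pchar R].-nat (p ^ k)%N.
Proof. by rewrite pnatX pnatE ?pR //; case/andP: pR. Qed.

Lemma frobD k (a b : R) : (a + b) ^+ (p ^ k) = a ^+ (p ^ k) + b ^+ (p ^ k).
Proof. by rewrite exprDn_pchar ?pchar_pow. Qed.

Lemma frobN k (a : R) : (- a) ^+ (p ^ k) = - a ^+ (p ^ k).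
Proof. by rewrite exprNn_pchar ?pchar_pow. Qed.

Lemma frobB k (a b : R) : (a - b) ^+ (p ^ k) = a ^+ (p ^ k) - b ^+ (p ^ k).
Proof. by rewrite frobD frobN. Qed.

Lemma frob_sum k (I : Type) (s : seq I) (E : I -> R) :
  (\sum_(i <- s) E i) ^+ (p ^ k) = \sum_(i <- s) E i ^+ (p ^ k).
Proof.
elim: s => [|i s IH]; last by rewrite !big_cons frobD IH.
by rewrite !big_nil expr0n expn_eq0; case: (p) pR => // /andP[].
Qed.
End Frobenius.

Section TraceCurve.
Variables (p n : nat) (p_prime : prime p) (n_gt1 : (1 < n)%N).
Local Notation q := (p ^ n)%N.
Local Notation l := (p ^ n.-1)%N.
Variables (K : finFieldType) (cardK : #|K| = (q ^ 2)%N).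

Lemma pcharK : p \in [pchar K].
Proof. by apply: (@card_finPcharP _ _ (n * 2)); rewrite // cardK -expnM. Qed.

Lemma pcharKX : p \in [pchar {poly K}].
Proof. by rewrite pchar_poly pcharK. Qed.

Lemma char_gt1 : (1 < p)%N. Proof. exact: prime_gt1. Qed.
Lemma q_eq_pl : q = (p * l)%N. Proof. by rewrite -expnS prednK // ltnW. Qed.
Lemma q_gt1 : (1 < q)%N. Proof. by rewrite -(expn0 p) ltn_exp2l ?char_gt1 // ltnW. Qed.
Lemma l_gt1 : (1 < l)%N.
Proof. by rewrite -(expn0 p) ltn_exp2l ?char_gt1 // -ltnS prednK // ltnW. Qed.

Lemma expq2 (c : K) : c ^+ q ^+ q = c.
Proof. by rewrite -exprM mulnn -cardK expf_card. Qed.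

(** On F_q, the trace to F_p. *)
Definition trace_poly : {poly K} := \sum_(i < n) 'X^(p ^ i).
Local Notation L := trace_poly.

Lemma size_trace_tail : (size (\sum_(i < n.-1) 'X^(p ^ i) : {poly K})%R <= l)%N.
Proof.
apply: (leq_trans (size_sum _ _ _)); apply/bigmax_leqP => i _.
by rewrite size_polyXn ltn_exp2l ?char_gt1.
Qed.

Lemma trace_polyE : L = 'X^l + \sum_(i < n.-1) 'X^(p ^ i).
Proof. by rewrite /L addrC; case: (n) n_gt1 => // k _; rewrite big_ord_recr. Qed.

Lemma size_trace_poly : size L = l.+1.
Proof. by rewrite trace_polyE size_polyDl size_polyXn // ltnS size_trace_tail. Qed.

Lemma trace_poly_monic : L \is monic.
Proof.
rewrite trace_polyE monicE lead_coefDl ?lead_coefXn //.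
by rewrite size_polyXn ltnS size_trace_tail.
Qed.

Lemma horner_trace_poly a : L.[a] = \sum_(i < n) a ^+ (p ^ i).
Proof. by rewrite horner_sum; apply: eq_bigr => i _; rewrite hornerXn. Qed.

Lemma trace_polyD a b : L.[a + b] = L.[a] + L.[b].
Proof.
rewrite !horner_trace_poly -big_split; apply: eq_bigr => i _.
by rewrite (frobD pcharK).
Qed.

(** L is additive, already as a polynomial. *)
Lemma trace_poly_shift ga : L.[ga] = 0 -> L \Po ('X + ga%:P) = L.
Proof.
move=> Lga; rewrite /L linear_sum /=.
transitivity (\sum_(i < n) ('X^(p ^ i) + (ga ^+ (p ^ i))%:P : {poly K})).
  apply: eq_bigr => i _; rewrite comp_Xn_poly (frobD pcharKX).
  by rewrite polyC_exp.
by rewrite big_split /= -rmorph_sum -horner_trace_poly Lga rmorph0 addr0.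
Qed.

Lemma trace_poly_frob : L ^+ p = L + 'X^q - 'X.
Proof.
rewrite -[p in L ^+ p]expn1 {1}/L (frob_sum pcharKX).
under eq_bigr => i _ do rewrite expn1 -exprM -expnSr.
rewrite /L; case: (n) n_gt1 => // k _.
rewrite big_ord_recr [in RHS]big_ord_recl /= expn0 expr1.
by move: (\sum_(i < k) _) ('X^(p ^ k.+1)) => a b; ring.
Qed.

(** With D = L - u and e = u^p - u, [trace_poly_frob] reads
    D^p - D = X^q - X - e.  Since e^q = - e, adding to this polynomial its q-th
    power gives X^(q^2) - X, so that D divides X^(q^2) - X. *)
Lemma trace_poly_split u : u ^+ q = - u -> L - u%:P %| 'X^#|K| - 'X.
Proof.
move=> uq; set D := L - u%:P.
pose e := u ^+ p - u.
have DB : D %| 'X^q - 'X - e%:P.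
  have -> : 'X^q - 'X - e%:P = D ^+ p - D.
    rewrite -[p in D ^+ p]expn1 (frobB pcharKX) !expn1 trace_poly_frob /D /e.
    rewrite polyCB polyC_exp; move: ('X^q) (u%:P ^+ p) => a b; ring.
  rewrite dvdp_subl // dvdp_exp ?prime_gt0 //.
have eq : e ^+ q = - e.
  rewrite /e (frobB pcharK) exprAC uq -[p in (- u) ^+ p]expn1 (frobN pcharK) expn1.
  by rewrite opprK opprB addrC.
have -> : 'X^#|K| - 'X = ('X^q - 'X - e%:P) ^+ q + ('X^q - 'X - e%:P).
  rewrite !(frobB pcharKX) -exprM mulnn -cardK -polyC_exp eq polyCN.
  by move: ('X^#|K|) ('X^q) (e%:P) => a b c; ring.
by rewrite dvdp_addr // dvdp_exp // expn_gt0 prime_gt0.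
Qed.

Lemma card_fibre u : u ^+ q = - u -> #|[set b | L.[b] == u]%SET| = l.
Proof.
move=> uq; have <- : (size (L - u%:P)).-1 = l.
  rewrite size_polyDl size_trace_poly //.
  rewrite size_polyN ltnS (leq_trans (size_polyC_leq1 _)) // expn_gt0 prime_gt0 //.
rewrite -(card_roots_dvd_genPoly (trace_poly_split uq)); apply: eq_card => b.
by rewrite !inE rootE hornerD hornerN hornerC subr_eq0.
Qed.

(** X^(q + 1) - 1 divides X^(q^2) - X. *)
Lemma card_unit_norm : #|[set x : K | x ^+ q.+1 == 1]%SET| = q.+1.
Proof.
have sz : size ('X^(q.+1) - 1%:P : {poly K}) = q.+2 by rewrite size_XnsubC.
rewrite -[RHS]/(q.+2.-1) -sz -card_roots_dvd_genPoly; last first.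
  have -> : 'X^#|K| - 'X = 'X * (('X^(q.+1)) ^+ q.-1 - 1 : {poly K}).
    rewrite mulrBr mulr1 -exprM -exprS cardK; congr ('X^_ - _).
    by have := q_gt1; case: q => // k _; rewrite /= -mulnn; lia.
  by rewrite dvdp_mull // [_ ^+ q.-1 - 1]subrX1 dvdp_mulr.
by apply: eq_card => x; rewrite !inE rootE hornerD hornerN hornerC hornerXn subr_eq0.
Qed.

(** c^q - c, for c in F_(q^2) but not in F_q. *)
Lemma trace_zero_exists : exists2 w : K, w != 0 & w ^+ q = - w.
Proof.
have [c cq] : exists c : K, c ^+ q != c.
  apply/existsP; apply: contraT; rewrite negb_exists => /forallP all.
  have : (size (enum K) < size ('X^q - 'X : {poly K})%R)%N.
    have sX : (size (- 'X : {poly K}) < size ('X^q : {poly K}))%N.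
      by rewrite size_polyN size_polyX size_polyXn ltnS q_gt1.
    apply: max_poly_roots; rewrite ?enum_uniq //.
      by rewrite -size_poly_eq0 size_polyDl // size_polyXn.
    apply/allP => c _; rewrite rootE hornerD hornerN hornerXn hornerX subr_eq0.
    by have := all c; rewrite negbK.
  rewrite -cardE cardK size_polyDl ?size_polyN ?size_polyX ?size_polyXn ?ltnS ?q_gt1 //.
  by rewrite leqNgt -{1}[q]expn1 ltn_exp2l ?q_gt1.
exists (c ^+ q - c); first by rewrite subr_eq0.
by rewrite (frobB pcharK) expq2 opprB.
Qed.

End TraceCurve.

Section TraceCode.
Variables (p n : nat) (p_prime : prime p) (n_gt1 : (1 < n)%N).
Local Notation q := (p ^ n)%N.
Local Notation l := (p ^ n.-1)%N.
Variables (K : finFieldType) (cardK : #|K| = (q ^ 2)%N).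
Variables (w : K) (wq : w ^+ q = - w).
Local Notation L := (trace_poly p n K).
Local Notation S := (curve_points l p L w).

Lemma weight_Y : (p * l).+1 = q.+1.
Proof. by rewrite -q_eq_pl. Qed.

Lemma fibre_trace (al : K) : (w * al ^+ q.+1) ^+ q = - (w * al ^+ q.+1).
Proof.
rewrite exprMn wq mulNr; congr (- (_ * _)).
by rewrite -exprM mulSn exprD exprM (expq2 cardK) -exprSr.
Qed.

Lemma card_curve_points : #|S| = (q ^ 2 * l)%N.
Proof.
rewrite -cardK -sum1_card.
pose fibre (al : K) := [set b | L.[b] == w * al ^+ q.+1]%SET.
transitivity (\sum_(pt : K * K | pt.2 \in fibre pt.1) 1)%N.
  by apply: eq_bigl => pt; rewrite !inE weight_Y.
rewrite -(pair_big_dep xpredT (fun al b => b \in fibre al) (fun _ _ => 1%N)) /=.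
under eq_bigr => al _ do
  rewrite sum1_card (card_fibre p_prime n_gt1 cardK (fibre_trace al)).
by rewrite sum_nat_const.
Qed.

Definition trace_kernel : seq K := enum [set b | L.[b] == 0]%SET.

Lemma trace_kernel_size : size trace_kernel = l.
Proof.
rewrite -cardE (card_fibre p_prime n_gt1 cardK) // expr0n oppr0.
by rewrite expn_eq0 (gtn_eqF (prime_gt0 p_prime)).
Qed.

(** The points (1, b) lie over x = 1; each factor y - b vanishes at the q + 1 points
    (x, b) with x ^ (q + 1) = 1. *)
Definition fibre_product (s : nat) : {poly {poly K}} :=
  \prod_(b <- take s (enum [set b | L.[b] == w]%SET)) ('X - b%:P%:P).

Variables (s : nat) (ltsl : (s < l)%N).
Local Notation bs := (take s (enum [set b | L.[b] == w]%SET)).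

Lemma size_bs : size bs = s.
Proof.
rewrite size_takel // -cardE (card_fibre p_prime n_gt1 cardK) //.
exact: ltnW.
Qed.

Lemma fibre_product_size : size (fibre_product s) = s.+1.
Proof. by rewrite size_prod_XsubC size_bs. Qed.

Lemma fibre_product_filtered : filtered l p (fibre_product s) (s * q.+1).
Proof.
rewrite /fibre_product -{2}size_bs; elim: bs => [|b t IH].
  rewrite big_nil => i [|j] lt; rewrite -polyC1 coefC /= ?coef0 //.
  by rewrite -polyC1 coefC; case: i lt => //; rewrite !muln0.
rewrite big_cons mulSn; apply: filteredM => // i j lt.
rewrite coefB coefX !coefC; move: lt; rewrite weight_Y; case: j => [|[|j]] /= lt.
- by rewrite sub0r coefN coefC; case: i lt => [|i]; rewrite ?oppr0 // !muln0.
- by rewrite subr0 coef1; case: i lt => //; rewrite muln0 muln1 ltnn.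
- by rewrite subr0 coef0.
Qed.

Lemma fibre_product_zeros : (s * q.+1 <= #|zeros l p L w (fibre_product s)|)%N.
Proof.
pose A := [set x : K | x ^+ q.+1 == 1]%SET; pose B := [set b in bs]%SET.
have cA : #|A| = q.+1 by apply: (card_unit_norm p_prime n_gt1 cardK).
have cB : #|B| = s.
  rewrite cardsE; have /card_uniqP-> : uniq bs by rewrite take_uniq ?enum_uniq.
  exact: size_bs.
have <- : #|finset.setX A B| = (s * q.+1)%N by rewrite cardsX cA cB mulnC.
apply/subset_leq_card/fintype.subsetP => -[x b].
rewrite !inE /= => /andP[/eqP xq bin]; rewrite weight_Y xq mulr1.
have := mem_take bin; rewrite mem_enum inE => -> /=.
rewrite /value /point_eval /fibre_product rmorph_prod /= prodf_seq_eq0.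
apply/hasP; exists b => //=; apply/eqP.
by rewrite [LHS]point_evalB point_eval_Y point_eval_const /= subrr.
Qed.

End TraceCode.

(** * Counting monomials *)

Lemma sum_triangle r a :
  sumn [seq (r * (a - j.+1)).+1 | j <- iota 0 a] = (a + r * 'C(a, 2))%N.
Proof.
elim: a => [|k IH]; first by rewrite /= muln0.
rewrite /= (iotaDl 1 0 k) -map_comp.
rewrite (eq_map (_ : _ =1 (fun j => (r * (k - j.+1)).+1))) // IH.
by rewrite subn1 /= binS bin1 mulnDr; lia.
Qed.

Section TriangleMonomials.
Variables (l r a : nat).
Hypotheses (a_gt0 : (0 < a)%N) (a_lt_l : (a < l)%N).
Local Notation m := (r * l).+1.

Definition triangle : seq (nat * nat) :=
  [seq (i, j) | j <- iota 0 a, i <- iota 0 (r * (a - j.+1)).+1].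

Lemma triangle_uniq : uniq triangle.
Proof.
apply: allpairs_uniq_dep; first exact: iota_uniq.
  by move=> j _; apply: iota_uniq.
by move=> [j i] [j' i'] _ _ /= [-> ->].
Qed.

(** With d = a - 1 - j < l, the condition l i <= m d = l (r d) + d means i <= r d. *)
Lemma triangleP i j :
  ((i, j) \in triangle) = (j < l)%N && (l * i + m * j <= m * a.-1)%N.
Proof.
have -> : ((i, j) \in triangle) = (j < a)%N && (i <= r * (a - j.+1))%N.
  apply/allpairsPdep/andP => [[j' [i' []]]|[ja ir]].
    by rewrite !mem_iota /= !add0n => ja ir [-> ->].
  by exists j, i; rewrite !mem_iota /= !add0n.
have [ja|aj] := ltnP j a; last first.
  rewrite [(_ + _ <= _)%N]leqNgt (leq_trans _ (leq_addl _ _)) ?andbF //.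
  by rewrite ltn_pmul2l // prednK.
rewrite (ltn_trans ja a_lt_l) /=; set d := (a - j.+1)%N.
have -> : (m * a.-1 = m * d + m * j)%N.
  by rewrite -mulnDr /d; congr (_ * _)%N; move: ja a_gt0; clear; lia.
rewrite leq_add2r mulSn mulnAC [(r * d * l)%N]mulnC.
have ltd : (d < l)%N by apply: leq_ltn_trans a_lt_l; apply: leq_subr.
have [le|lt] := leqP i (r * d).
  by apply/esym; rewrite (leq_trans _ (leq_addl _ _)) // leq_mul2l le orbT.
apply/esym/negbTE; rewrite -ltnNge (@leq_trans (l * (r * d).+1)) ?leq_mul //.
by rewrite mulnS ltn_add2r.
Qed.

Lemma size_triangle : size triangle = (a + (r * a * (a - 1)) %/ 2)%N.
Proof.
have -> : ((r * a * (a - 1)) %/ 2 = r * 'C(a, 2))%N.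
  rewrite bin2 -mulnA subn1 -divn2 muln_divA //.
  by rewrite dvdn2 oddM; case: (a) => //= k; rewrite andNb.
have -> : size triangle = sumn [seq (r * (a - j.+1)).+1 | j <- iota 0 a].
  rewrite size_allpairs_dep; congr sumn; apply: eq_map => j.
  by rewrite size_iota.
exact: sum_triangle.
Qed.
End TriangleMonomials.

(** * Existence of a code with the given parameters *)

Local Open Scope nat_scope.

(* Both divisions are exact and the subtraction does not truncate: a - 1 is
   less than q / p, so (q + 1) * (a - 1) < q ^ 3 / p. *)
Theorem corollary5p2 (p n q : nat) (hp : prime p) (hn : 2 <= n)
    (hq : q = p ^ n) (hqp : 3 <= q %/ p)
    (K : finFieldType) (hK : #|K| = q ^ 2)
    (a : nat) (ha2 : 2 <= a) (ha : a <= q %/ p - 1) :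
  exists C : {vspace 'rV[K]_(q ^ 3 %/ p)},
    is_AG_code C /\
    code_parameters C
      (a + (p * a * (a - 1)) %/ 2)
      (q ^ 3 %/ p - (q + 1) * (a - 1)).
Proof.
subst q; have p0 := prime_gt0 hp; have n1 : 1 < n by [].
set l := p ^ n.-1; have l1 : 1 < l := l_gt1 hp n1.
have qpl : p ^ n = p * l by apply: q_eq_pl.
have q1 := q_gt1 hp n1.
have ltal : a < l.
  by move: ha (ltnW l1); rewrite qpl mulKn //; clear; lia.
have a0 : 0 < a by apply: ltnW.
have [w w0 wq] := trace_zero_exists hp n1 hK.
(* An l-th root of w, as p q l = q ^ 2 and w ^ (q ^ 2) = w. *)
pose mu := (w ^+ (p * p ^ n))%R.
have mu0 : mu != 0%R by rewrite expf_neq0.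
have muw : (mu ^+ l = w)%R.
  by rewrite /mu -exprM mulnAC -qpl mulnn -hK expf_card.
have monL := trace_poly_monic hp n1 K.
have szL := size_trace_poly hp n1 K.
have [F [y Fy]] := curve_field_exists p l1 monL szL mu0 muw.
pose Ga := trace_kernel p n K.
have uGa : uniq Ga := enum_uniq _.
have szGa : size Ga = l := trace_kernel_size hp n1 hK.
have Ga0 ga : ga \in Ga -> (trace_poly p n K).[ga]%R = 0%R.
  by rewrite mem_enum inE => /eqP.
have GaL ga : ga \in Ga -> (trace_poly p n K \Po ('X + ga%:P) = trace_poly p n K)%R.
  by move/Ga0; apply: (trace_poly_shift hp hK).
have GaD ga de : ga \in Ga -> de \in Ga -> (ga + de)%R \in Ga.
  move=> /Ga0 Ega /Ga0 Ede; rewrite mem_enum inE.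
  by rewrite (trace_polyD hp hK) Ega Ede addr0.
(* The length as it comes from counting points: q^2 fibres of l points. *)
have cube : (p ^ n) ^ 3 %/ p = (p ^ n) ^ 2 * l.
  by move: qpl; move: (p ^ n) => Q E; rewrite expnSr {2}E mulnCA mulKn.
have cardS : #|curve_points l p (trace_poly p n K) w| = (p ^ n) ^ 3 %/ p.
  by rewrite (card_curve_points hp n1 hK wq) cube.
pose W := (p * l).+1 * a.-1.
have WN : W < (p ^ n) ^ 3 %/ p.
  rewrite cube /W -qpl (@leq_trans ((p ^ n).+1 * l)) //.
    by rewrite ltn_pmul2l // prednK // ltnW.
  rewrite leq_mul2r; apply/orP; right.
  by move: q1; move: (p ^ n) => Q; clear; nia.
have WE : W = (p ^ n + 1) * (a - 1) by rewrite /W -qpl addn1 subn1.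
have um := triangle_uniq p a.
have tP i j := triangleP p a0 ltal i j.
have ltsl : a.-1 < l by apply: leq_ltn_trans ltal; apply: leq_pred.
have szf := fibre_product_size hp n1 hK wq ltsl.
have f_reg : regular l p mu W (fibre_product p n w a.-1).
  apply/andP; split; first by rewrite szf prednK // ltnW.
  apply: (wt_le _ l1); rewrite /W mulnC -qpl.
  exact: (fibre_product_filtered hp n1 hK wq ltsl).
have f0 : fibre_product p n w a.-1 != 0%R by rewrite -size_poly_eq0 szf.
exists (code cardS (triangle p a)); split.
  exact: (code_is_AG l1 monL szL mu0 muw Fy uGa szGa GaL cardS WN um tP).
split.
  rewrite (dim_code l1 monL szL mu0 muw Fy uGa szGa GaL GaD cardS WN um tP).
  exact: size_triangle.
rewrite -WE.
apply: (code_min_distance l1 monL szL mu0 muw Fy uGa szGa GaL GaD cardS WN um tP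
          f_reg) => //.
rewrite /W mulnC -qpl; exact: (fibre_product_zeros hp n1 hK wq ltsl).
Qed.
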